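(* Let $G$ be a finite solvable group and let $\sigma$ be a set of primes which is a cut-set for $\Gamma(G)$, and let $\pi_1(G)$, $\pi_2(G)$ be as defined in the context. Then there is a normal series \[1\le G_0\le G_1\le G_2\le G_3\le G\] of $G$ such that $G_0$ and $G_2/G_1$ are $\sigma$-groups, $G_1/G_0$ is a nilpotent $\pi_1(G)$-group, $G_3/G_2$ is a nilpotent $\pi_2(G)$-group, and $G/G_3$ is not nilpotent only if $2\in\pi_2(G)$ and $G/O(G)\simeq (2.S_4)^-$. In this last case, $\ell_F(G/G_3)=2$.
   Context: For a finite group $G$, the prime graph (Gruenberg–Kegel graph) $\Gamma(G)$ has vertex set $\pi(G)$, the set of primes dividing $|G|$, and two distinct vertices $p,q$ are adjacent iff $G$ has an element of order $pq$. For a graph $\Gamma$ with vertex set $V$ and a set $\sigma$, $\Gamma-\sigma$ is the induced subgraph on $V\setminus\sigma$; $\sigma$ is a cut-set of $\Gamma$ if $\Gamma-\sigma$ is disconnected. For a set of primes $\pi$, $O_\pi(G)$ is the largest normal $\pi$-subgroup of $G$, $\sigma'$ denotes the complement of $\sigma$ in the set of primes, $O(G)$ is the largest normal subgroup of odd order, $F(G)$ is the Fitting subgroup and $\ell_F(G)$ the Fitting length. Convention for $\pi_1,\pi_2$: if $G$ is solvable and $\sigma$ is a cut-set of $\Gamma(G)$, then $\Gamma(G)-\sigma$ (which is the prime graph of a Hall $\sigma'$-subgroup of $G$) has exactly two connected components, both complete, with nonempty vertex sets; $F(G/O_\sigma(G))$ is then a $\pi$-group for the vertex set $\pi$ of one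 of these components, and $\pi_1(G)$ denotes the vertex set of the component containing $\pi(F(G/O_\sigma(G)))$, while $\pi_2(G)$ denotes the vertex set of the other component. $(2.S_4)^-$ denotes the double cover of $S_4$ whose Sylow $2$-subgroup is generalized quaternion (the binary octahedral group). *)

(* Defs.v *)
From HB Require Import structures.
From mathcomp Require Import all_boot all_fingroup all_solvable.
Set Implicit Arguments. Unset Strict Implicit. Unset Printing Implicit Defensive.
Import GroupScope.
Local Open Scope group_scope.

Definition pg_adj (gT : finGroupType) (G : {set gT}) (p q : nat) : bool :=
  [&& p \in \pi(G), q \in \pi(G), p != q & [exists x in G, #[x] == (p * q)%N]].

Definition pg_vert (gT : finGroupType) (G : {set gT}) (sigma : nat_pred) (p : nat) : bool :=
  (p \in \pi(G)) && (p \notin sigma).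

Definition pg_connected (gT : finGroupType) (G : {set gT}) (sigma : nat_pred)
    (p q : nat) : Prop :=
  pg_vert G sigma p /\
  exists s : seq nat,
    path (fun a b => pg_adj G a b && pg_vert G sigma b) p s /\ last p s = q.

Definition cut_set (gT : finGroupType) (G : {set gT}) (sigma : nat_pred) : Prop :=
  exists p q, [/\ pg_vert G sigma p, pg_vert G sigma q & ~ pg_connected G sigma p q].

Definition pg_component (gT : finGroupType) (G : {set gT}) (sigma : nat_pred)
    (C : nat_pred) : Prop :=
  exists p, pg_vert G sigma p /\ forall q, q \in C <-> pg_connected G sigma p q.

Fixpoint fitting_series (gT : finGroupType) (G : {group gT}) (n : nat) : {group gT} :=
  match n with
  | 0 => 1%G
  | n'.+1 => (coset (fitting_series G n') @*^-1 'F(G / fitting_series G n'))%G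
  end.

(* Fitting length: least n with F_n = G (for solvable G this is <= #|G|). *)
Definition fitting_length (gT : finGroupType) (G : {group gT}) : nat :=
  find (fun n => fitting_series G n == G :> {set gT}) (iota 0 #|G|.+1).

(* (2.S_4)^- : the double cover of S_4 (central extension by a group of order
   2 with quotient S_4) whose Sylow 2-subgroup is generalized quaternion
   (necessarily of order 16). *)
Definition binary_octahedral (gT : finGroupType) (H : {group gT}) : Prop :=
  exists Z : {group gT},
    [/\ Z \subset 'Z(H), #|Z| = 2%N,
        (H / Z)%G \isog [set: 'S_4]%G &
        exists2 P : {group gT}, P \in 'Syl_2(H) & P \isog 'Q_16].

(* Main.v *)
(** Pass to H = G / O_sigma(G), where F = F(H) is a pi1-group containing its
    centralizer, and every element of prime order q outside sigma and pi1 acts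
    on F without nontrivial fixed points. If D is normalized by such an element
    b and C_D(b) = 1, then a sum over the conjugates of <b> in D<b> shows that
    D centralizes every solvable group of coprime order on which D<b> acts with
    b fixed-point-free. This has three consequences.
    - Any two primes outside sigma and pi1 are adjacent, hence lie in pi2.
    - Let S be normal in H with S / F a sigma-group. Then O_p(H / S) = 1 for p
      in pi1: a Sylow p-subgroup P of the preimage is normalized by some b as
      above, and b centralizes each b-invariant abelian subgroup of S / F,
      since its commutator with b acts trivially on F. This forces P to
      centralize S / F, so that P F is nilpotent and P lies in F.
    - Elementary abelian q-subgroups of H are cyclic for q in pi2.
    With G1 and G2 the preimages of F(G / G0) and O_sigma(G / G1), the Fitting
    subgroup G3 / G2 of G / G2 is then a pi2-group with cyclic or quaternion
    Sylow subgroups, and G / G3 is visible in their outer automorphism groups: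
    it can fail to be nilpotent only through Out(Q_8) = S_3. *)
Require Import Defs.
From HB Require Import structures.
From mathcomp Require Import all_boot all_fingroup all_solvable.
From mathcomp Require Import ssralg.
Set Implicit Arguments. Unset Strict Implicit. Unset Printing Implicit Defensive.
Import GroupScope.
Local Open Scope group_scope.

(** * Regular actions of elements of prime order *)

Lemma cent1_trivg_comm_inj (gT : finGroupType) (D : {group gT}) (b : gT) :
  'C_D[b] = 1 -> {in D &, injective (fun y => [~ y, b])}.
Proof.
move=> regDb x y Dx Dy /= eq_xy.
have: y * x^-1 \in 'C_D[b].
  rewrite inE groupM ?groupV //=; apply/cent1P/commgP/conjg_fixP.
  move: eq_xy; rewrite !commgEl => eq_xy.
  by rewrite conjMg conjVg -(mulgK (x ^ b) (y * x^-1)) -(mulgA y) eq_xy mulKVg.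
by rewrite regDb => /set1P/(canRL (mulgKV _)); rewrite mul1g.
Qed.

(** An injective self-map of the finite set [D] is onto, so a claim about all of [D] may be checked
    on commutators with [b]. *)
Lemma cent1_trivg_comm_surj (gT : finGroupType) (D : {group gT}) (b u : gT) :
  b \in 'N(D) -> 'C_D[b] = 1 -> u \in D -> exists2 y, y \in D & u = [~ y, b].
Proof.
move=> nDb regDb Du; have injD := cent1_trivg_comm_inj regDb.
have sRD: [set [~ y, b] | y in D] \subset D.
  by apply/subsetP=> _ /imsetP[y Dy ->]; rewrite commgEl groupM ?groupV ?memJ_norm.
have: u \in [set [~ y, b] | y in D].
  have /eqP-> // : [set [~ y, b] | y in D] == D.
  by rewrite eqEcard sRD card_in_imset //=.
by case/imsetP=> y Dy ->; exists y.
Qed.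

Lemma prime_order_cent1X (gT : finGroupType) (D : {group gT}) (b : gT) i :
  prime #[b] -> ~~ (#[b] %| i) -> 'C_D[b ^+ i] = 'C_D[b].
Proof.
move=> pr_b ndvd; rewrite -!cent_cycle; congr (D :&: 'C(_)).
by apply/esym/eqP; rewrite -/(generator _ _) generator_coprime prime_coprime.
Qed.

Lemma cent1_trivgJ (gT : finGroupType) (M : {group gT}) (b d : gT) :
  d \in 'N(M) -> 'C_M[b] = 1 -> 'C_M[b ^ d] = 1.
Proof.
by move=> nMd regMb; rewrite cent1J -{1}(normP nMd) -conjIg regMb conjs1g.
Qed.

Section NormSums.

Import FiniteModule GRing.Theory.
Local Open Scope ring_scope.

Variables (gT : finGroupType) (M : {group gT}) (abM : abelian M).

(** Applying [x] shifts the summands cyclically, so the sum is a fixed point of [x] in [M]. *)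
Lemma actr_norm_eq0 (x : gT) (u : fmod_of abM) :
  x \in 'N(M) -> 'C_M[x] = 1%g -> \sum_(i < #[x]) u ^@ (x ^+ i)%g = 0.
Proof.
move=> nMx regMx; have on := prednK (order_gt0 x); rewrite -on; set S := \sum_(i < _) _.
have nMX i : (x ^+ i)%g \in 'N(M) by rewrite groupX.
have fixS : S ^@ x = S.
  have shift i : (u ^@ (x ^+ i)%g) ^@ x = u ^@ (x ^+ i.+1)%g.
    by rewrite expgSr actrM.
  rewrite /S actr_sum; under eq_bigr => i _ do rewrite shift.
  rewrite big_ord_recr [RHS]big_ord_recl /= on expg_order expg0 addrC.
  by congr (_ + _); apply: eq_bigr => i _; rewrite /bump leq0n add1n.
apply: val_inj; have: val S \in 'C_M[x].
  by rewrite inE fmodP /=; apply/cent1P/commgP/conjg_fixP; rewrite -fmvalJ ?fixS.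
by rewrite regMx => /set1P.
Qed.

Lemma actr_eq0_coprime (u : fmod_of abM) n : coprime #|M| n -> u *+ n = 0 -> u = 0.
Proof.
move=> coMn un0; apply: val_inj; apply/eqP; rewrite -order_eq1 -dvdn1.
rewrite -(eqP coMn) dvdn_gcd order_dvdG ?fmodP //= order_dvdn -fmvalZ un0.
by rewrite fmval0.
Qed.

End NormSums.

Section RegularAction.

Import FiniteModule GRing.Theory.
Local Open Scope ring_scope.

(** Additively, the aim is [u *+ #|D| = T u] with [T] the sum over [D]. The right side is fixed by
    [D], and [#|D|] can be cancelled because it is prime to [#|M|]. *)
Lemma regular_cent_abelian (gT : finGroupType) (M D : {group gT}) (b : gT) :
    abelian M -> D \subset 'N(M) -> b \in 'N(M) -> b \in 'N(D) -> prime #[b] ->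
    coprime #|M| #|D| -> 'C_M[b] = 1%g -> 'C_D[b] = 1%g ->
  D \subset 'C(M).
Proof.
move=> abM nMD nMb nDb pr_b coMD regMb regDb.
pose T (u : fmod_of abM) := \sum_(d in D) u ^@ d.
have TD : {morph T : u v / u + v}.
  by move=> u v; rewrite /T -big_split; apply: eq_bigr => d _; rewrite actAr.
have T0 : T 0 = 0 by rewrite /T big1 // => d _; rewrite act0r.
have fixT u e : e \in D -> (T u) ^@ e = T u.
  move=> De; rewrite /T actr_sum [RHS](reindex_inj (mulIg e)) /=.
  apply: eq_big => [d | d Dd]; first by rewrite groupMr.
  by rewrite actrM ?(subsetP nMD).
(* Sum [u ^@ (b ^ d) ^+ i] over [d] and [i]: the terms with [i = 0] give [u *+ #|D|];
   for [i != 0], [d |-> [~ b ^+ i, d]] permutes [D], so they add up to [- T u]. *)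
have defT u : u *+ #|D| = T u.
  have sum0: \sum_(d in D) \sum_(i < #[b]) u ^@ ((b ^+ i) ^ d)%g = 0.
    rewrite big1 // => d Dd; have nMd := subsetP nMD d Dd.
    have := @actr_norm_eq0 _ _ abM (b ^ d)%g u (groupJ nMb nMd) (cent1_trivgJ nMd regMb).
    rewrite orderJ => sum0; rewrite -[RHS]sum0.
    by apply: eq_bigr => i _; rewrite conjXg.
  have normu := @actr_norm_eq0 _ _ abM b u nMb regMb.
  move: sum0 normu; rewrite exchange_big /= -(prednK (prime_gt0 pr_b)).
  rewrite !big_ord_recl /= expg0 actr1.
  under eq_bigr => d _ do rewrite conj1g actr1.
  rewrite sumr_const => sum0 /eqP; rewrite addr_eq0 => /eqP def_u.
  move/eqP: sum0; rewrite addr_eq0 => /eqP->.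
  have: T u + T (\sum_(i < #[b].-1) u ^@ (b ^+ bump 0 i)%g) = 0.
    by rewrite -TD {1}def_u addNr T0.
  move/eqP; rewrite addr_eq0 => /eqP->; congr (- _).
  rewrite (big_morph T TD T0); apply: eq_bigr => i _.
  set c := (b ^+ _)%g.
  have regDc: 'C_D[c] = 1%g.
    rewrite prime_order_cent1X // gtnNdvd //.
    by rewrite /bump leq0n add1n -[X in _ < X]prednK ?prime_gt0 // ltnS ltn_ord.
  have nDc : c \in 'N(D) by rewrite groupX.
  have nMc : c \in 'N(M) by rewrite groupX.
  rewrite /T.
  have injc: {in D &, injective (fun d => [~ c, d])}.
    move=> x y Dx Dy /=; rewrite -(invg_comm x) -(invg_comm y) => /invg_inj.
    exact: (cent1_trivg_comm_inj regDc).
  have imD: [set [~ c, d] | d in D] = D.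
    apply/eqP; rewrite eqEcard card_in_imset // leqnn andbT.
    apply/subsetP=> _ /imsetP[d Dd ->]; rewrite commgEr groupM //.
    by rewrite -groupV conjVg invgK memJ_norm.
  transitivity (\sum_(d in [set [~ c, d] | d in D]) (u ^@ c) ^@ d); last by rewrite imD.
  rewrite big_imset //=; apply: eq_bigr => d Dd.
  have nMd := subsetP nMD d Dd.
  by rewrite -actrM ?groupR // conjg_mulR.
apply/centsP=> d Dd m Mm; apply/commute_sym/commgP/conjg_fixP.
have nMd := subsetP nMD d Dd; pose u := fmod abM m.
have: u ^@ d - u = 0.
  by apply: (actr_eq0_coprime coMD); rewrite mulrnBl -actZr defT fixT // subrr.
move/eqP; rewrite subr_eq0 => /eqP/(congr1 val).
by rewrite fmvalJ //= fmodK.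
Qed.

End RegularAction.

(** Under coprime action ['C_R(A)] covers the fixed points of [R / N], which are everything here; it
    also contains [N]. *)
Lemma coprime_cent_quotient (gT : finGroupType) (A R N : {group gT}) :
    N <| R -> A \subset 'N(R) -> A \subset 'N(N) -> coprime #|R| #|A| -> solvable R ->
    A \subset 'C(N) -> A / N \subset 'C(R / N) ->
  A \subset 'C(R).
Proof.
move=> nsNR nRA nNA coRA solR cNA cRNA; have [sNR nNR] := andP nsNR.
have defCq := coprime_quotient_cent sNR nNA coRA solR.
rewrite centsC; apply: (subset_trans _ (subsetIr R _)).
rewrite -(quotientSGK nNR) ?subsetI ?sNR 1?centsC // defCq.
by rewrite subsetI subxx centsC.
Qed.

Lemma order_coset_coprime (gT : finGroupType) (N : {group gT}) (b : gT) :
  b \in 'N(N) -> coprime #|N| #[b] -> #[coset N b] = #[b].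
Proof.
move=> nNb coNb; have nNB: <[b]> \subset 'N(N) by rewrite cycle_subG.
rewrite !orderE -quotient_cycle //; apply/esym/card_isog/quotient_isog => //.
exact: coprime_TIg.
Qed.

(** Induction on [#|M|], splitting [M] at its derived subgroup [N]. Coprimeness of [#|M|] and [#[b]]
    keeps [b] fixed-point-free on [M / N] and [D / N], where the abelian case applies. *)
Lemma regular_cent (gT : finGroupType) (M D : {group gT}) (b : gT) :
    solvable M -> D \subset 'N(M) -> b \in 'N(M) -> b \in 'N(D) -> prime #[b] ->
    coprime #|M| #|D| -> coprime #|M| #[b] -> 'C_M[b] = 1 -> 'C_D[b] = 1 ->
  D \subset 'C(M).
Proof.
have [n] := ubnP #|M|; elim: n gT M D b => // n IHn gT M D b /ltnSE-leMn.
move=> solM nMD nMb nDb pr_b coMD coMb regMb regDb.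
have [-> | ntM] := eqsVneq M 1; first exact: cents1.
pose N := M^`(1)%G; have nsNM: N <| M := der_normal 1 M.
have ltNM: N \proper M := sol_der1_proper solM (subxx M) ntM.
have [sNM nNM] := andP nsNM.
have nND : D \subset 'N(N) := char_norm_trans (der_char 1 M) nMD.
have nNb : b \in 'N(N) := subsetP (char_norms (der_char 1 M)) b nMb.
have b'N : coprime #|N| #[b] := coprimeSg sNM coMb.
apply: (coprime_cent_quotient nsNM) => //.
  apply: (IHn _ N D b) => //.
  - exact: leq_trans (proper_card ltNM) leMn.
  - exact: solvableS solM.
  - exact: coprimeSg coMD.
  by apply/trivgP; rewrite -regMb setSI.
have obN: #[coset N b] = #[b] by apply: order_coset_coprime.
have sbN : <[b]> \subset 'N(N) by rewrite cycle_subG.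
apply: (@regular_cent_abelian _ (M / N)%G (D / N)%G (coset N b)); rewrite ?obN //.
- exact: sub_der1_abelian.
- exact: quotient_norms.
- by rewrite -cycle_subG -quotient_cycle // quotient_norms // cycle_subG.
- by rewrite -cycle_subG -quotient_cycle // quotient_norms // cycle_subG.
- exact: coprime_morph.
- rewrite -cent_cycle -quotient_cycle // -(coprime_quotient_cent sNM sbN) //.
  by rewrite cent_cycle regMb quotient1.
rewrite -cent_cycle -quotient_cycle //.
rewrite -(@coprime_norm_quotient_cent _ <[b]> D N) ?cycle_subG //; last exact: solvableS solM.
by rewrite cent_cycle regDb quotient1.
Qed.

(** Each element of [P] has the form [[~ y, b] = (b^-1) ^ y * b], and [y] normalizes the centralizer
    of [A]. *)
Lemma cent_regular_cent (gT : finGroupType) (P A : {group gT}) (b : gT) :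
    b \in 'N(P) -> 'C_P[b] = 1 -> P \subset 'N(A) -> b \in 'C(A) ->
  P \subset 'C(A).
Proof.
move=> nPb regPb nAP cAb; apply/subsetP=> u Pu.
have [y Py ->] := cent1_trivg_comm_surj nPb regPb Pu.
rewrite commgEr groupM // memJ_norm ?groupV //.
exact: subsetP (norms_cent nAP) y Py.
Qed.

(** * Elements with symmetric orbit sums *)

Section SymmetricOrbitSums.

Variables (gT : finGroupType) (M P : {group gT}) (b : gT).
Hypotheses (abM : abelian M) (nMP : P \subset 'N(M)) (nPb : b \in 'N(P)).
Hypotheses (regPb : 'C_P[b] = 1) (pr_b : prime #[b]) (odd_b : odd #[b]).
Hypothesis cMP : forall u v m, u \in P -> v \in P -> m \in M -> m ^ (u * v) = m ^ (v * u).

(* Written additively, the hypothesis on [L] reads [y + y^-1 = y^b + (y^b)^-1], i.e.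
   [(1 - y^-1 y^b) (1 - y^-1 (y^b)^-1) = 0]; since [P] acts on the minimal [L]
   through a commutative group, one of the two factors vanishes on [L]. *)
Lemma abelian_orbit_dichotomy (L : {group gT}) y :
    minnormal L P -> L \subset M -> y \in P ->
    (forall m, m \in L -> forall y, y \in P ->
       m ^ y * m ^ y^-1 = m ^ (y ^ b) * m ^ (y ^ b)^-1) ->
  ([~ y, b] \in 'C(L)) || (y ^ b * y \in 'C(L)).
Proof.
move=> minL sLM Py symL; have /andP[ntL nLP] := mingroupp minL.
have Pyb : y ^ b \in P by rewrite memJ_norm.
set z := [~ y, b]; have Pz : z \in P by rewrite /z commgEl groupM ?groupV.
have nLz := subsetP nLP z Pz.
have nCP : P \subset 'N('C_L[z]).
  apply/subsetP=> u Pu; rewrite inE; apply/subsetP=> _ /imsetP[l /setIP[Ll czl] ->].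
  rewrite inE memJ_norm ?(subsetP nLP) // Ll; apply/cent1P/commgP/conjg_fixP.
  rewrite -conjgM cMP ?(subsetP sLM) // conjgM; congr (_ ^ u).
  by apply/conjg_fixP/commgP/cent1P.
have [C1 | ntC] := eqVneq 'C_L[z] 1; last first.
  have /mingroupP[_ minL'] := minL.
  have/= defL := minL' 'C_L[z]%G _ (subsetIl _ _).
  by rewrite -sub_cent1; apply/orP; left; apply/setIidPl; rewrite defL ?ntC.
apply/orP; right; rewrite -groupV; apply/centP=> l Ll.
set w := (_ * _)^-1; have Pw : w \in P by rewrite /w groupV groupM.
have abL := abelianS sLM abM.
have LJ u : u \in P -> l ^ u \in L by move=> Pu; rewrite memJ_norm ?(subsetP nLP).
(* This is [symL] at [l ^ y^-1]. Additively it says that [(1 - w)(1 - z)] kills [l], so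
   [l^-1 * l ^ w] is fixed by [z]. *)
have eqw : l * l ^ (w * z) = l ^ z * l ^ w.
  have := symL _ (LJ _ (groupVr Py)) y Py; rewrite -!conjgM mulVg conjg1.
  rewrite -(invMg (y ^ b)) -commgEl -/z -/w => <-; congr (_ * _).
  rewrite /w invMg -mulgA. rewrite [LHS]conjgM (cMP (groupVr Pyb) Pz) ?(subsetP sLM) ?LJ ?groupV //.
  by rewrite /z commgEl mulgK -conjgM.
apply/commute_sym/commgP/conjg_fixP; suff: l^-1 * l ^ w \in 'C_L[z].
  by rewrite C1 => /set1P/(canRL (mulKVg _)); rewrite mulg1.
rewrite inE groupM ?groupV ?LJ //=; apply/cent1P/commgP/conjg_fixP.
rewrite conjMg conjVg -conjgM; apply: (mulgI (l ^ z * l)).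
by rewrite {1}(centsP abL _ (LJ _ Pz) _ Ll) -(mulgA l) mulKVg -(mulgA (l ^ z)) mulKVg.
Qed.

(** The symmetric elements form a [P]-invariant subgroup [X]. If it is nontrivial, it contains a
    minimal [P]-invariant [L], and [abelian_orbit_dichotomy] leads to [P] centralizing [L], against
    ['C_M(P) = 1]. *)
Lemma symmetric_orbit_trivial m :
    'C_M(P) = 1 -> m \in M ->
    (forall y, y \in P -> m ^ y * m ^ y^-1 = m ^ (y ^ b) * m ^ (y ^ b)^-1) ->
  m = 1.
Proof.
move=> regMP Mm symm.
pose sym x := [forall y in P, x ^ y * x ^ y^-1 == x ^ (y ^ b) * x ^ (y ^ b)^-1].
pose X := [set x in M | sym x].
have MJ x u : x \in M -> u \in P -> x ^ u \in M by move=> *; rewrite memJ_norm ?(subsetP nMP).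
have gX : group_set X.
  apply/group_setP; split.
    by rewrite inE group1; apply/forall_inP=> y _; rewrite !conj1g.
  move=> x1 x2; rewrite !inE => /andP[Mx1 /forall_inP s1] /andP[Mx2 /forall_inP s2].
  rewrite groupM //; apply/forall_inP=> y Py; have Pyb : y ^ b \in P by rewrite memJ_norm.
  have swap u v : u \in P -> v \in P ->
      (x1 * x2) ^ u * (x1 * x2) ^ v = (x1 ^ u * x1 ^ v) * (x2 ^ u * x2 ^ v).
    move=> Pu Pv; rewrite !conjMg -(mulgA (x1 ^ u)) (mulgA (x2 ^ u) (x1 ^ v)).
    rewrite (centsP abM _ (MJ _ _ Mx2 Pu) _ (MJ _ _ Mx1 Pv)) -(mulgA (x1 ^ v)).
    by rewrite (mulgA (x1 ^ u)).
  by rewrite !swap ?groupV // (eqP (s1 y Py)) (eqP (s2 y Py)).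
have nXP : P \subset 'N(Group gX).
  apply/subsetP=> u Pu; rewrite inE; apply/subsetP=> _ /imsetP[x /[!inE] /andP[Mx sx] ->].
  rewrite MJ //; apply/forall_inP=> y Py; have Pyb : y ^ b \in P by rewrite memJ_norm.
  have := forall_inP sx y Py => /eqP sxy.
  rewrite -!conjgM !(cMP Pu) ?groupV // !(conjgM x _ u) -!conjMg.
  by rewrite sxy.
have [X1 | ntX] := eqVneq X 1.
  by apply/set1P; rewrite -[[set 1]]X1 inE Mm; apply/forall_inP=> y /symm->.
have [L minL sLX] := @minnormal_exists _ P (Group gX) ntX nXP.
have sLM : L \subset M by apply: subset_trans sLX _; apply/subsetP=> x /setIdP[].
have symL x : x \in L -> forall y, y \in P ->
       x ^ y * x ^ y^-1 = x ^ (y ^ b) * x ^ (y ^ b)^-1.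
  by move=> /(subsetP sLX)/setIdP[_ /forall_inP sx] y /sx/eqP.
have /andP[ntL nLP] := mingroupp minL.
have nCP := norms_cent nLP.
suff sPC : P \subset 'C(L).
  by case/negP: ntL; rewrite -subG1 -regMP subsetI sLM centsC.
have PJb y : y \in P -> y ^ b \in P by move=> Py; rewrite memJ_norm.
have [all_z | /forall_inPn[y1 Py1 Cy1]] :=
  boolP [forall y in P, [~ y, b] \in 'C(L)].
  apply/subsetP=> u Pu; have [y Py ->] := cent1_trivg_comm_surj nPb regPb Pu.
  exact: (forall_inP all_z).
(* [P] is not the union of two proper subgroups. *)
have all_w y : y \in P -> y ^ b * y \in 'C(L).
  move=> Py; have [/(negP Cy1)//|Cw1] := orP (abelian_orbit_dichotomy minL sLM Py1 symL).
  have [Cz|//] := orP (abelian_orbit_dichotomy minL sLM Py symL).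
  have [|] := orP (abelian_orbit_dichotomy minL sLM (groupM Py1 Py) symL).
    by rewrite commMgJ groupMr // memJ_norm ?(subsetP nCP) // (negPf Cy1).
  move=> Cw; apply/centP=> l Ll; apply/commute_sym/commgP/conjg_fixP.
  have fixC u x : u \in 'C(L) -> x \in L -> x ^ u = x.
    by move=> /centP cu Lx; apply/conjg_fixP/commgP/commute_sym/cu.
  have := fixC _ _ Cw Ll; rewrite conjMg conjgM (cMP (PJb _ Py1) (PJb _ Py)) ?(subsetP sLM) //.
  have Llyb : l ^ (y ^ b) \in L by rewrite memJ_norm ?(subsetP nLP) ?PJb.
  by rewrite (conjgM _ (y ^ b)) (conjgM _ y1) -(conjgM _ (y1 ^ b)) (fixC _ _ Cw1) // -conjgM.
(* Modulo the centralizer of [L], [y ^ b] is now [y^-1], so [y ^ (b ^+ 2)] is [y]. As [#[b]] is odd,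
   [b ^+ 2] is still fixed-point-free, and the commutators [[~ y, b ^+ 2]] fill [P]. *)
have ndvdb2 : ~~ (#[b] %| 2).
  by rewrite dvdn_prime2 //; apply: contraTneq odd_b => ->.
have regPb2 : 'C_P[b ^+ 2] = 1 by rewrite prime_order_cent1X.
apply/subsetP=> u Pu.
have [y Py ->] := cent1_trivg_comm_surj (groupX 2 nPb) regPb2 Pu.
have Cy := all_w y Py; have Cyb := all_w _ (PJb y Py).
rewrite commgEl expgS expg1 conjgM.
have eq_a a c : y^-1 * a = (a * c) ^ y * (c * y)^-1.
  by rewrite conjgE invMg -!mulgA mulKVg mulgV mulg1.
rewrite (eq_a _ (y ^ b)).
by rewrite groupM ?groupV // memJ_norm ?(subsetP nCP).
Qed.

End SymmetricOrbitSums.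

(** For odd [#[b]], induction on [#|P| + #|R|] reduces to [R = [~: R, P]], with [P] acting on [R]
    through an abelian group and centralizing the derived subgroup of [R], which is then central.
    Orbit sums show that [b] is fixed-point-free on the abelianization of [R], so
    [regular_cent_abelian] makes [P] trivial there, against [R = [~: R, P]]. *)
Lemma regular_cent_of_abelian (gT : finGroupType) (P R : {group gT}) (b : gT) :
    solvable P -> solvable R -> prime #[b] -> b \in 'N(P) -> b \in 'N(R) ->
    P \subset 'N(R) -> coprime #|R| #|P| -> coprime #|R| #[b] -> 'C_P[b] = 1 ->
    (forall A : {group gT}, A \subset R -> abelian A -> b \in 'N(A) -> b \in 'C(A)) ->
  P \subset 'C(R).
Proof.
have [n] := ubnP (#|P| + #|R|); elim: n P R => // n IHn P R /ltnSE-leRn.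
move=> solP solR pr_b nPb nRb nRP coRP coRb regPb abR.
(* An involution inverts each [[~ x, b]]. Since it must also centralize the cyclic group this
   generates, the commutator squares to 1, and [R] has odd order. *)
have [ev_b | odd_b] := even_prime pr_b.
  apply: (cent_regular_cent nPb) => //; apply/centP=> x Rx; apply/commute_sym.
  have Rd: [~ x, b] \in R by rewrite commgEl groupM ?groupV ?memJ_norm.
  have bb : b * b = 1 by rewrite -[b * b]/(b ^+ 2) -ev_b expg_order.
  have dV : [~ x, b] ^ b = [~ x, b]^-1.
    by rewrite commgEl conjMg conjVg -conjgM bb conjg1 (invMg x^-1) invgK.
  have: b \in 'C(<[[~ x, b]]>).
    by apply: abR; rewrite ?cycle_subG ?cycle_abelian // inE -cycleJ dV cycleV.
  rewrite cent_cycle => /cent1P/commute_sym/commgP/conjg_fixP; rewrite dV => dVd.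
  apply/commgP; rewrite -order_eq1 -dvdn1 -(eqP coRb) dvdn_gcd order_dvdG //=.
  by rewrite ev_b order_dvdn expgS -{1}dVd mulVg.
have [-> | ntR] := eqsVneq R 1; first exact: cents1.
have [-> | ntP] := eqsVneq P 1; first exact: sub1G.
have nRB : <[b]> \subset 'N(R) by rewrite cycle_subG.
have nPB : <[b]> \subset 'N(P) by rewrite cycle_subG.
have sSR : [~: R, P] \subset R by rewrite commg_subl.
have nSP : P \subset 'N([~: R, P]) := commg_normr P R.
have nSR : R \subset 'N([~: R, P]) := commg_norml R P.
have nSb : b \in 'N([~: R, P]) by rewrite -cycle_subG normsR.
case/eqVproper: (sSR) => [defR | ltSR]; last first.
  apply: (@coprime_cent_quotient _ P R [~: R, P]) => //; first exact/andP.
    apply: IHn => //.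
    - by apply: leq_trans leRn; rewrite ltn_add2l proper_card.
    - exact: solvableS solR.
    - exact: coprimeSg coRP.
    - exact: coprimeSg coRb.
    by move=> A sAS; apply: abR; apply: subset_trans sSR.
  by rewrite quotient_cents2r // commGC.
have sQP : P^`(1) \subset P := der_sub 1 P.
have cRQ : P^`(1) \subset 'C(R).
  apply: (IHn P^`(1)%G R) => //.
  - apply: leq_trans leRn; rewrite ltn_add2r proper_card //.
    exact: (sol_der1_proper solP (subxx P)).
  - exact: solvableS solP.
  - exact: subsetP (char_norms (der_char 1 P)) b nPb.
  - exact: subset_trans nRP.
  - by rewrite coprime_sym; apply: coprimeSg sQP _; rewrite coprime_sym.
  by apply/trivgP; rewrite -regPb setSI.
have sTR : R^`(1) \subset R := der_sub 1 R.
have ltTR : R^`(1) \proper R := sol_der1_proper solR (subxx R) ntR.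
have nTP : P \subset 'N(R^`(1)) := char_norm_trans (der_char 1 R) nRP.
have nTb : b \in 'N(R^`(1)) := subsetP (char_norms (der_char 1 R)) b nRb.
have cTP : P \subset 'C(R^`(1)).
  apply: (IHn P R^`(1)%G) => //.
  - by apply: leq_trans leRn; rewrite ltn_add2l proper_card.
  - exact: solvableS solR.
  - exact: coprimeSg coRP.
  - exact: coprimeSg coRb.
  by move=> A sAS; apply: abR; apply: subset_trans sTR.
(* Three subgroups lemma for [R], [P] and the derived subgroup of [R], with one factor [R] written
   as [[~: R, P]]. *)
have cRT : R^`(1) \subset 'C(R).
  rewrite centsC; apply/commG1P; rewrite -{1}defR; apply: three_subgroup.
    by rewrite (commG1P cTP) comm1G.
  apply/commG1P; apply: subset_trans (_ : R^`(1) \subset _); last by rewrite centsC.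
  by rewrite commg_subl (der_norm 1).
have Tcomm u v : u \in R -> v \in R -> [~ u, v] \in R^`(1).
  by move=> Ru Rv; rewrite mem_commg.
have RJ x y : x \in R -> y \in P -> x ^ y \in R.
  by move=> Rx Py; rewrite memJ_norm ?(subsetP nRP).
have commJ u v w : u \in R -> v \in R -> w \in P -> [~ u ^ w, v ^ w] = [~ u, v].
  move=> Ru Rv Pw; rewrite -conjRg; apply/conjg_fixP/commgP.
  exact/commute_sym/(centsP cTP _ Pw _ (Tcomm _ _ Ru Rv)).
have PM u v m : u \in P -> v \in P -> m \in R -> m ^ (u * v) = m ^ (v * u).
  move=> Pu Pv Rm; rewrite (commgC u) conjgM; apply/conjg_fixP/commgP/commute_sym.
  by apply: (centsP cRQ); rewrite ?mem_commg ?RJ ?groupM.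
have comm1 u v w : u \in R -> v \in R -> w \in R -> [~ u, v, w] = 1.
  move=> Ru Rv Rw; apply/eqP/commgP; exact: (centsP cRT _ (Tcomm _ _ Ru Rv)).
have commM u v w : u \in R -> v \in R -> w \in R -> [~ u * v, w] = [~ u, w] * [~ v, w].
  by move=> Ru Rv Rw; rewrite commMgR comm1 // mulg1.
have commM' u v w : u \in R -> v \in R -> w \in R -> [~ w, u * v] = [~ w, v] * [~ w, u].
  by move=> Ru Rv Rw; rewrite commgMR comm1 // mulg1.
(* The products [c^y c^(y^-1)] commute pairwise, so if [b] fixes [c] they generate a
   [b]-invariant abelian group, which [b] must centralize. *)
pose X (c y : gT) : gT := c ^ y * c ^ y^-1.
have cX c y1 y2 : c \in R -> y1 \in P -> y2 \in P -> commute (X c y1) (X c y2).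
  move=> Rc Py1 Py2; have [Py1V Py2V] := (groupVr Py1, groupVr Py2).
  (* Conjugation by [y1 * y2] fixes commutators and carries [c ^ y1^-1], [c ^ y2^-1] to [c ^ y2],
     [c ^ y1]. So the four terms in the bilinear expansion of the commutator of [X c y1] and
     [X c y2] cancel in pairs. *)
  have eq1 : [~ c ^ y1^-1, c ^ y2^-1] = [~ c ^ y1, c ^ y2]^-1.
    rewrite invg_comm -(commJ _ _ (y1 * y2)) ?RJ ?groupM // -!conjgM mulKg.
    by rewrite (PM _ (y1 * y2)) ?groupM // mulgK.
  have eq2 : [~ c ^ y1^-1, c ^ y2] = [~ c ^ y1, c ^ y2^-1]^-1.
    rewrite invg_comm -(commJ _ _ (y1 * y2^-1)) ?RJ ?groupM // -!conjgM mulKg.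
    by rewrite (PM _ (y1 * y2^-1)) ?groupM // mulgKV.
  have [Ra Ra'] := (RJ _ _ Rc Py1, RJ _ _ Rc Py1V).
  have [Rd Rd'] := (RJ _ _ Rc Py2, RJ _ _ Rc Py2V).
  apply/commgP; rewrite /X (commM _ _ _ Ra Ra' (groupM Rd Rd')).
  rewrite !(commM' _ _ _ Rd Rd') // eq1 eq2.
  by rewrite mulgA mulgK mulgV.
have fixX (c y : gT) : c \in 'C_R[b] -> y \in P -> X c (y ^ b) = X c y.
  case/setIP=> Rc /cent1P/commute_sym cbc Py.
  have cb : c ^ b = c by apply/conjg_fixP/commgP.
  have XJ z : (X c z) ^ b = X c (z ^ b) by rewrite /X conjMg (conjJg c z) (conjJg c z^-1) cb conjVg.
  rewrite -XJ; apply/conjg_fixP/commgP.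
  have: b \in 'C(<<[set X c y | y in P]>>).
    apply: abR.
    - rewrite gen_subG; apply/subsetP=> _ /imsetP[z Pz ->].
      exact: groupM (RJ _ _ Rc Pz) (RJ _ _ Rc (groupVr Pz)).
    - rewrite abelian_gen; apply/centsP=> _ /imsetP[y1 Py1 ->] _ /imsetP[y2 Py2 ->].
      exact: cX.
    rewrite (subsetP (norm_gen _)) // inE; apply/subsetP=> _ /imsetP[_ /imsetP[z Pz ->] ->].
    by rewrite XJ imset_f // memJ_norm.
  by rewrite cent_gen => /centP/(_ _ (imset_f _ Py))/commute_sym.
have coTP : coprime #|R^`(1)| #|P| := coprimeSg sTR coRP.
have coTb : coprime #|R^`(1)| #[b] := coprimeSg sTR coRb.
have solT : solvable R^`(1) := solvableS sTR solR.
pose T := R^`(1)%G; have nTB : <[b]> \subset 'N(T) by rewrite cycle_subG.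
have nTR : R \subset 'N(T) := der_norm 1 R.
have obT : #[coset T b] = #[b] by apply: order_coset_coprime.
have abM : abelian (R / T) by apply: sub_der1_abelian.
have regPbT : 'C_(P / T)[coset T b] = 1.
  rewrite -cent_cycle -quotient_cycle //.
  by rewrite -(@coprime_norm_quotient_cent _ <[b]> P T) // cent_cycle regPb quotient1.
have nPbT : coset T b \in 'N(P / T).
  by rewrite -cycle_subG -quotient_cycle // quotient_norms.
have nRbT : coset T b \in 'N(R / T).
  by rewrite -cycle_subG -quotient_cycle // quotient_norms.
have nRPT : P / T \subset 'N(R / T) by apply: quotient_norms.
have coRPT : coprime #|R / T| #|P / T| by apply: coprime_morph.
have regMP : 'C_(R / T)(P / T) = 1.
  by rewrite -[in 'C_ _(_)]defR quotientR // coprime_abel_cent_TI.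
have ntM : R / T != 1.
  by rewrite -subG1 quotient_sub1 //; case/andP: ltTR.
case/negP: ntM; rewrite -subG1 -regMP subsetI subxx centsC.
apply: (@regular_cent_abelian _ (R / T)%G (P / T)%G (coset T b)); rewrite ?obT //.
(* What remains is that [b] is fixed-point-free on [R / T]. By coprimeness a fixed point lifts to
   some [c] in ['C_R[b]], for which [fixX] gives the symmetry of orbit sums. *)
apply/trivgP/subsetP=> m CMm; apply/set1P; have [Mm _] := setIP CMm.
apply: (@symmetric_orbit_trivial _ (R / T)%G (P / T)%G (coset T b)); rewrite ?obT //.
  move=> _ _ _ /morphimP[u Nu Pu ->] /morphimP[v Nv Pv ->] /morphimP[x Nx Rx ->].
  by rewrite -!morphM // -!morphJ ?groupM // PM.
move: CMm; rewrite /= -cent_cycle -quotient_cycle // -coprime_quotient_cent // cent_cycle.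
case/morphimP=> c Nc Cc -> _ /morphimP[y Ny Py ->].
have cosetX z : z \in P -> coset T c ^ coset T z * coset T c ^ (coset T z)^-1 = coset T (X c z).
  move=> Pz; have Nz := subsetP nTP z Pz.
  by rewrite /X morphM ?groupJ ?groupV // !morphJ ?groupV // morphV.
have -> : coset_morphism T y ^ coset T b = coset T (y ^ b) by rewrite morphJ.
by rewrite !cosetX ?fixX // memJ_norm.
Qed.

(** * Cores of quotients by extensions of the Fitting subgroup *)

(** If [C] exceeded [C :&: F], it would contain a normal [M] with [M / (C :&: F)] abelian and
    nontrivial. As [C :&: F] is central in [M], such an [M] is nilpotent of class at most 2 and so
    lies in [F]. *)
Lemma solvable_cent_Fitting (gT : finGroupType) (G : {group gT}) :
  solvable G -> 'C_G('F(G)) \subset 'F(G).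
Proof.
move=> solG; set F := 'F(G); set C := 'C_G(F).
have nsFG : F <| G := Fitting_normal G.
have nsCG : C <| G by rewrite /normal subsetIl normsI ?normG ?norms_cent ?normal_norm.
have nsZG : C :&: F <| G by apply: normalI.
apply/setIidPl/eqP; rewrite eqEsubset subsetIl /=.
have sZC : C :&: F \subset C := subsetIl _ _.
rewrite -quotient_sub1 ?(subset_trans (normal_sub nsCG)) ?normal_norm //.
rewrite subG1; apply/negPn/negP=> ntCZ.
have solCZ : solvable (C / (C :&: F)).
  by rewrite quotient_sol // (solvableS _ solG) // normal_sub.
have [Mq [sMC nsMG ntM abM]] := solvable_norm_abelem solCZ (quotient_normal (C :&: F) nsCG) ntCZ.
have [M defM sZM nsMG'] := inv_quotientN nsZG nsMG.
have nZM : M \subset 'N(C :&: F) := subset_trans (normal_sub nsMG') (normal_norm nsZG).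
have sMC' : M \subset C.
  by rewrite -(quotientSGK nZM) // -defM.
have cMF : F \subset 'C(M) by rewrite centsC (subset_trans sMC') ?subsetIr.
have sM'Z : M^`(1) \subset C :&: F.
  rewrite der1_min // -defM; have [r _ abMr] := is_abelemP abM.
  exact: abelem_abelian abMr.
have nilM : nilpotent M.
  apply/small_nil_class/(@leq_trans 2) => //; rewrite nil_class2 subsetI der_sub.
  by rewrite (subset_trans sM'Z) // (subset_trans (subsetIr _ _)).
case/negP: ntM; rewrite defM -subG1 quotient_sub1 // subsetI sMC'.
exact: Fitting_max.
Qed.

Section RegularPrimeAction.

Variables (gT : finGroupType) (H : {group gT}) (sigma pi : nat_pred) (p q : nat).
Hypotheses (solH : solvable H) (piF : pi.-group 'F(H)).
Hypotheses (sigma'pi : {subset pi <= sigma^'}) (pi_p : p \in pi).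
Hypotheses (pr_q : prime q) (pi'q : q \notin pi) (sigma'q : q \notin sigma).
Hypothesis regq : forall b y, b \in H -> y \in H -> #[b] = q -> pi.-elt y ->
  commute b y -> y = 1.

Let F := ('F(H))%G.
Let F' := ('O_p^'(F))%G.

Lemma regular_pi_subgroup (D : {group gT}) b :
  D \subset H -> pi.-group D -> b \in H -> #[b] = q -> 'C_D[b] = 1.
Proof.
move=> sDH piD Hb ob; apply/trivgP/subsetP=> y /setIP[Dy /cent1P cby].
apply/set1P; apply: (regq Hb (subsetP sDH y Dy) ob) => //; exact: mem_p_elt Dy.
Qed.

Lemma pi_subgroup_coprime (D : {group gT}) : pi.-group D -> coprime #|D| q.
Proof.
move=> piD; rewrite coprime_sym prime_coprime //; apply: contra pi'q => qD.
exact: (pgroupP piD).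
Qed.

Let nsFH : F <| H := Fitting_normal H.

(** Both [P] and [F'] are [pi]-groups, so [b] is fixed-point-free on each, and [regular_cent]
    applies. *)
Lemma pgroup_cent_Fitting_p' (P : {group gT}) b :
    P \subset H -> p.-group P -> b \in 'N_H(P) -> #[b] = q -> P \subset 'C(F').
Proof.
move=> sPH pP /setIP[Hb nPb] ob.
have nsF'H : F' <| H := gFnormal_trans _ nsFH.
have piF' : pi.-group F' := pgroupS (pcore_sub _ _) piF.
apply: (@regular_cent _ F' P b); rewrite ?ob //.
- by rewrite (solvableS _ solH) ?normal_sub.
- by rewrite (subset_trans sPH) ?normal_norm.
- exact: subsetP (normal_norm nsF'H) b Hb.
- by rewrite coprime_sym; apply: pnat_coprime pP (pcore_pgroup _ _).
- exact: pi_subgroup_coprime.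
- by apply: regular_pi_subgroup => //; apply: normal_sub.
by apply: regular_pi_subgroup => //; apply: sub_pgroup pP => r /eqnP->.
Qed.

Variable S : {group gT}.
Hypotheses (nsSH : S <| H) (sFS : F \subset S) (sigmaSF : sigma.-group (S / F)).

(** [S / F] is generated by Sylow subgroups invariant under [P] and [b], one for each prime. On each
    of them [regular_cent_of_abelian] reduces the claim to [b] centralizing the [b]-invariant
    abelian subgroups [A0]. *)
Lemma Sylow_cent_quotient_Fitting (P : {group gT}) b :
    P \subset H -> p.-group P -> b \in 'N_H(P) -> #[b] = q ->
  P / F \subset 'C(S / F).
Proof.
move=> sPH pP NHb ob; have [Hb nPb] := setIP NHb.
have [sSH nSH] := andP nsSH; have [sFH nFH] := andP nsFH.
have nFP : P \subset 'N(F) := subset_trans sPH nFH.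
have nFb : b \in 'N(F) := subsetP nFH b Hb.
have nFB : <[b]> \subset 'N(F) by rewrite cycle_subG.
have piP : pi.-group P by apply: sub_pgroup pP => r /eqnP->.
have coFb : coprime #|F| #[b] by rewrite ob pi_subgroup_coprime.
have obF : #[coset F b] = q by rewrite order_coset_coprime.
have defB : <[coset F b]> = <[b]> / F by rewrite quotient_cycle.
pose A := (P / F <*> <[coset F b]>)%G.
have nPbF : <[coset F b]> \subset 'N(P / F).
  by rewrite defB quotient_norms // cycle_subG.
have nSPF : P / F \subset 'N(S / F) by rewrite quotient_norms // (subset_trans sPH).
have nSbF : <[coset F b]> \subset 'N(S / F).
  by rewrite defB quotient_norms // cycle_subG (subsetP nSH).
have sigma'P : sigma^'.-group (P / F).
  by apply: quotient_pgroup; apply: sub_pgroup piP.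
have sigma'b : sigma^'.-group <[coset F b]>.
  by rewrite /pgroup -orderE obF pnatE // !inE.
have sigma'A : sigma^'.-group A by rewrite /= norm_joinEr // pgroupM sigma'P.
have solA : solvable A.
  have sAH : A \subset H / F by rewrite join_subG quotientS //= defB quotientS // cycle_subG.
  exact: solvableS sAH (quotient_sol _ solH).
have nSA : A \subset 'N(S / F) by rewrite join_subG nSPF.
have coSA : coprime #|S / F| #|A| := pnat_coprime sigmaSF sigma'A.
have solSF : solvable (S / F) by rewrite quotient_sol // (solvableS sSH).
rewrite centsC.
pose T := [set R : {group coset_of F} | Sylow (S / F) R & R \subset 'C(P / F)].
rewrite -(@Sylow_transversal_gen _ T (S / F)%G); first 1 last.
- by move=> R; rewrite inE => /andP[/SylowP[r _ /pHall_sub]].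
- move=> r pi_r; have [r_pr sigma_r] : prime r /\ r \in sigma.
    move: pi_r; rewrite mem_primes => /and3P[r_pr _ rS]; split=> //.
    exact: (pgroupP sigmaSF).
  have [R sylR nRA] := sol_coprime_Sylow_exists r solA nSA coSA.
  exists R => //; rewrite inE (p_Sylow sylR) centsC /=.
  have [sRS rR _] := and3P sylR.
  have /andP[nRP nRb] : (P / F \subset 'N(R)) && (<[coset F b]> \subset 'N(R)).
    by rewrite -join_subG.
  have solR : solvable R := solvableS sRS solSF.
  have coRP : coprime #|R| #|P / F|.
    exact: (coprimeSg sRS (coprimegS (joing_subl _ _) coSA)).
  have coRb : coprime #|R| q.
    have := coprimeSg sRS (coprimegS (joing_subr (P / F) _) coSA).
    by rewrite -orderE obF.
  apply: (@regular_cent_of_abelian _ (P / F)%G R (coset F b)); rewrite ?obF //=.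
  + by rewrite quotient_sol // (solvableS sPH).
  + by rewrite -cycle_subG.
  + by rewrite -cycle_subG.
  + rewrite -cent_cycle defB -(@coprime_norm_quotient_cent _ <[b]> P F) //.
    * by rewrite cent_cycle (regular_pi_subgroup _ _ Hb) ?quotient1.
    * by rewrite cycle_subG.
    exact: solvableS solH.
  move=> A0 sA0R abA0 nA0b.
  have nA0B : <[coset F b]> \subset 'N(A0) by rewrite cycle_subG.
  have rA0 : r.-group A0 := pgroupS sA0R rR.
  have coA0b : coprime #|A0| #|<[coset F b]>|.
    by rewrite -orderE obF (coprimeSg sA0R).
  (* As [A0] is abelian of order prime to that of [b], [b] is fixed-point-free on [Dq]. A
     [b]-invariant Sylow subgroup [D1] of the preimage carries this back to [H], where it can act on
     [F]. *)
  set Dq := [~: A0, <[coset F b]>]%G.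
  have sDA : Dq \subset A0 by rewrite commg_subl.
  have regD : 'C_Dq(<[coset F b]>) = 1 by apply: coprime_abel_cent_TI.
  suffices D1 : Dq :=: 1 by rewrite -cycle_subG; apply/commG1P; rewrite commGC.
  have sDSF : Dq \subset S / F := subset_trans sDA (subset_trans sA0R sRS).
  have rD : r.-group Dq := pgroupS sDA rA0.
  pose D := (coset F @*^-1 Dq)%G.
  have defD : D / F = Dq by rewrite cosetpreK.
  have nDb : b \in 'N(D).
    have: b \in coset F @*^-1 'N(Dq).
      by rewrite mem_morphpre // -cycle_subG commg_normr.
    exact: subsetP (morphpre_norm _ _) b.
  have sFD : F \subset D by rewrite -{1}(ker_coset F) /= ker_coset sub_cosetpre.
  have sDS : D \subset S.
    by rewrite sub_cosetpre_quo //; apply: normalS nsFH.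
  have nFD : D \subset 'N(F) := subset_trans sDS (subset_trans sSH nFH).
  have coDb : coprime #|D| #|<[b]>|.
    rewrite -(Lagrange sFD) coprimeMl coFb /= -card_quotient // defD -orderE ob.
    by rewrite (coprimeSg (subset_trans sDA sA0R)).
  have [D1 sylD1 nD1B] : exists2 D1 : {group gT}, r.-Sylow(D) D1 & <[b]> \subset 'N(D1).
    by apply: sol_coprime_Sylow_exists; rewrite ?cycle_subG // abelian_sol ?cycle_abelian.
  rewrite cycle_subG in nD1B; have [sD1D rD1 _] := and3P sylD1.
  have r'F : r^'.-group F.
    by apply: sub_pgroup piF => s pi_s; apply: contraTneq sigma_r => <-; apply: sigma'pi.
  have tiFD1 : F :&: D1 = 1 by rewrite coprime_TIg // coprime_sym (pnat_coprime rD1).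
  have nFD1 := subset_trans sD1D nFD.
  have sD1H : D1 \subset H := subset_trans sD1D (subset_trans sDS sSH).
  have defDq : D1 / F = Dq.
    by apply: (pHall_id (pi := r)) => //; rewrite -defD quotient_pHall.
  have regD1 : 'C_D1[b] = 1.
    apply/trivgP; rewrite -tiFD1 subsetI subsetIl andbT.
    rewrite -quotient_sub1; last by rewrite (subset_trans (subsetIl _ _)).
    have sCC : 'C_D1[b] / F \subset 'C_(D1 / F)(<[b]> / F).
      by rewrite -cent_cycle quotient_subcent.
    by rewrite (subset_trans sCC) // defDq -defB regD.
  (* By [regular_cent], [D1] centralizes [F] and hence lies in it; but [F] is an [r^']-group, so
     [D1], and with it [Dq], is trivial. *)
  have cD1F : D1 \subset 'C(F).
    apply: (@regular_cent _ F D1 b); rewrite ?ob //.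
    - by rewrite (solvableS _ solH).
    - by rewrite coprime_sym; apply: pnat_coprime rD1 r'F.
    - exact: pi_subgroup_coprime.
    exact: regular_pi_subgroup.
  have sD1F : D1 \subset F.
    by rewrite (subset_trans _ (solvable_cent_Fitting solH)) // subsetI sD1H.
  have D1_1 : D1 :=: 1 by apply/trivgP; rewrite -tiFD1 subsetI sD1F /=.
  by rewrite -defDq D1_1 quotient1.
by rewrite gen_subG; apply/bigcupsP=> R; rewrite inE => /andP[].
Qed.

Lemma pcore_quotient_Fitting_trivial : q %| #|H| -> 'O_p(H / S) = 1.
Proof.
move=> qH; have [sSH nSH] := andP nsSH; have [sFH nFH] := andP nsFH.
have [L defL sSL nsLH] := inv_quotientN nsSH (pcore_normal p (H / S)).
have [sLH nLH] := andP nsLH.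
have nSL : L \subset 'N(S) := subset_trans sLH nSH.
have [P sylP] := Sylow_exists p L; have [sPL pP _] := and3P sylP.
have sPH := subset_trans sPL sLH.
have nSP := subset_trans sPH nSH; have nFP := subset_trans sPH nFH.
have defPS : P / S = L / S.
  apply: (pHall_id (pi := p)); first by rewrite quotient_pHall.
  by rewrite /= -defL; apply: pcore_pgroup.
have piP : pi.-group P by apply: sub_pgroup pP => r /eqnP->.
(* The Frattini argument gives [S * 'N_H(P) = H], and [q] does not divide [#|S|], so Cauchy finds
   [b] in the normalizer. *)
have [b NHb ob] : {b | b \in 'N_H(P) & #[b] = q}.
  apply: Cauchy => //.
  have defH : S * 'N_H(P) = H.
    rewrite -[RHS](Frattini_arg nsLH sylP) -(quotientGK (_ : S <| L)) ?/normal ?sSL //.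
    rewrite -defPS quotientK // -mulgA; congr (_ * _).
    by rewrite mulSGid // subsetI sPH normG.
  have: q %| #|S| * #|'N_H(P)|.
    by apply: dvdn_trans qH _; rewrite -{1}defH mul_cardG dvdn_mulr.
  rewrite Euclid_dvdM // => /orP[qS|//].
  have: q %| #|F| * #|S / F|.
    by rewrite card_quotient ?Lagrange // (subset_trans sSH).
  rewrite Euclid_dvdM // => /orP[qF|qSF].
    by case/negP: pi'q; apply: (pgroupP piF).
  by case/negP: sigma'q; apply: (pgroupP sigmaSF).
have cFP' := pgroup_cent_Fitting_p' sPH pP NHb ob.
have cSP := Sylow_cent_quotient_Fitting sPH pP NHb ob.
have defLF : (S / F) * (P / F) = L / F.
  rewrite -quotientMl //; last exact: subset_trans sSH nFH.
  by rewrite -quotientK // defPS quotientGK // /normal sSL.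
(* [P / F] commutes with [S / F], so it is normal in their product [L / F]; being a Sylow subgroup
   it is the [p]-core there. *)
have nsPF : P / F <| H / F.
  have sylPF : p.-Sylow(L / F) (P / F) by rewrite quotient_pHall.
  have nsPL : P / F <| L / F.
    rewrite /normal quotientS //= -defLF mulG_subG normG andbT.
    by rewrite cents_norm // centsC.
  rewrite -(normal_Hall_pcore sylPF nsPL).
  exact: gFnormal_trans (quotient_normal F nsLH).
have nsOpL : 'O_p(F) <| L.
  apply: normalS (gFnormal_trans _ nsFH) => //.
  exact: subset_trans (pcore_sub _ _) (subset_trans sFS sSL).
have sOpP : 'O_p(F) \subset P.
  exact: subset_trans (pcore_max (pcore_pgroup _ _) nsOpL) (pcore_sub_Hall sylP).
have defPF : P * F = P * F'.
  have [_ eF _ _] := dprodP (nilpotent_pcoreC p (Fitting_nil H)).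
  by rewrite -[X in P * X = _]eF mulgA (mulGSid sOpP).
(* The product of [P] and [F] is normal in [H] and equals [P * F'], whose factors are nilpotent and
   commute; so it lies in the Fitting subgroup. *)
have sPF : P \subset F.
  apply: subset_trans (joing_subr F P) _; apply: Fitting_max.
    by rewrite /= norm_joinEr // -quotientK // -[X in _ <| X](quotientGK nsFH) cosetpre_normal.
  rewrite /= norm_joinEr // -(normC nFP) defPF mulg_nil 1?centsC //.
  by rewrite (pgroup_nil pP) (nilpotentS (pcore_sub _ _) (Fitting_nil H)).
by rewrite defL -defPS; apply/trivgP; rewrite quotient_sub1 // (subset_trans sPF).
Qed.

End RegularPrimeAction.

(** * Lifting and commuting elements *)

Section RegularAbelem.

Import FiniteModule GRing.Theory.
Local Open Scope ring_scope.

(** The norms of [u] under all the [a * b ^+ j] vanish. In their sum the terms away from the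
    identity also cancel, which leaves [u *+ q = 0]. *)
Lemma regular_commuting_pair_abelian (gT : finGroupType) (M : {group gT}) (a b : gT) (q : nat) :
    abelian M -> a \in 'N(M) -> b \in 'N(M) -> commute a b -> prime q ->
    coprime #|M| q -> #[b] = q -> 'C_M[b] = 1%g ->
    (forall j, #[(a * b ^+ j)%g] = q /\ 'C_M[(a * b ^+ j)%g] = 1%g) ->
  M :=: 1%g.
Proof.
move=> abM nMa nMb cab pr_q coMq ob regb regab.
apply/trivgP/subsetP=> m Mm; apply/set1P.
suffices u0 : fmod abM m = 0 by rewrite -(fmodK abM Mm) u0.
apply: (actr_eq0_coprime coMq); set u := fmod abM m.
have q_gt0 := prime_gt0 pr_q.
have: \sum_(j < q) \sum_(i < q) u ^@ ((a * b ^+ j) ^+ i)%g = 0.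
  rewrite big1 // => j _; have [oj regj] := regab j.
  by rewrite -[RHS](@actr_norm_eq0 _ _ abM _ u _ regj) ?oj // groupM ?groupX.
(* The terms with [i = 0] give [u *+ q]; for fixed [i != 0] the sum over [j] is the
   norm of [u ^@ a ^+ i] under [<[b ^+ i]>]. *)
rewrite exchange_big (bigD1 (Ordinal q_gt0)) //=.
under eq_bigr => j _ do rewrite expg0 actr1.
rewrite sumr_const card_ord [X in _ + X]big1 ?addr0 // => i nti.
set k := (i : nat); have k_gt0 : (0 < k)%N by move: nti; rewrite -val_eqE lt0n.
have bk : ~~ (#[b] %| k)%N by rewrite ob gtnNdvd // ltn_ord.
have obk : #[(b ^+ k)%g] = q.
  by rewrite orderXgcd ob (eqP (_ : coprime q k)) ?divn1 // prime_coprime // -ob.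
have regbk : 'C_M[(b ^+ k)%g] = 1%g by rewrite prime_order_cent1X ?ob // -ob.
rewrite -[RHS](@actr_norm_eq0 _ _ abM _ (u ^@ (a ^+ k)%g) _ regbk) ?groupX // obk.
apply: eq_bigr => j _; rewrite -actrM ?groupX // expgMn; last exact: commuteX.
by rewrite -!expgM mulnC.
Qed.

End RegularAbelem.

(** If [a] lies outside [<[b]>], no [a * b ^+ j] is trivial, so all of them act without fixed points
    on ['Z(M)]. This forces ['Z(M) = 1], impossible for a nontrivial nilpotent [M]. *)
Lemma regular_abelem_cyclic (gT : finGroupType) (M E : {group gT}) (q : nat) :
    nilpotent M -> M :!=: 1 -> E \subset 'N(M) -> q.-abelem E -> coprime #|M| q ->
    (forall x, x \in E -> x != 1 -> 'C_M[x] = 1) ->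
  cyclic E.
Proof.
move=> nilM ntM nME abE coMq regE.
have [-> | ntE] := eqsVneq E 1; first exact: cyclic1.
have qE := abelem_pgroup abE; have [pr_q _ _] := pgroup_pdiv qE ntE.
have oE x : x \in E -> x != 1 -> #[x] = q by apply: abelem_order_p abE.
have [b Eb ntb] := trivgPn _ ntE.
have [sEb | /subsetPn[a Ea b'a]] := boolP (E \subset <[b]>).
  exact: cyclicS sEb (cycle_cyclic b).
case/negP: (ntM); rewrite -center_nil_eq1 //; apply/eqP.
have nZE : E \subset 'N('Z(M)) := char_norm_trans (center_char M) nME.
have regZ x : x \in E -> x != 1 -> 'C_('Z(M))[x] = 1.
  move=> Ex ntx; apply/trivgP; rewrite -(regE x) // setSI //; exact: center_sub.
have ab_nt j : a * b ^+ j != 1.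
  by apply: contraNneq b'a => ab1; rewrite -(groupMr _ (mem_cycle b j)) ab1 group1.
have Eab j : a * b ^+ j \in E by rewrite groupM ?groupX.
apply: (@regular_commuting_pair_abelian _ 'Z(M)%G a b q) => //.
- exact: center_abelian.
- exact: (subsetP nZE).
- exact: (subsetP nZE).
- by apply: (centsP (abelem_abelian abE)).
- exact: coprimeSg (center_sub M) coMq.
- exact: oE.
- exact: regZ.
by move=> j; split; [apply: oE | apply: regZ].
Qed.

(** For [x] of order dividing [q], the group generated by [x] and ['Ohm_1('Z(Q))] is abelian, so its
    own ['Ohm_1] has order [q] and coincides with ['Ohm_1('Z(Q))]. The result feeds [prime_Ohm1P],
    which yields cyclic or quaternion groups. *)
Lemma abelem_cyclic_Ohm1 (gT : finGroupType) (Q : {group gT}) (q : nat) :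
    q.-group Q -> Q :!=: 1 ->
    (forall E : {group gT}, E \subset Q -> q.-abelem E -> cyclic E) ->
  #|'Ohm_1(Q)| = q.
Proof.
move=> qQ ntQ cycE; have [pr_q _ _] := pgroup_pdiv qQ ntQ.
have qZ : q.-group 'Z(Q) := pgroupS (center_sub Q) qQ.
have ntZ : 'Z(Q) != 1.
  by apply: contra ntQ => /eqP/(trivg_center_pgroup qQ)->.
have sZQ : 'Ohm_1('Z(Q)) \subset Q := subset_trans (Ohm_sub 1 _) (center_sub Q).
have card_q (E : {group gT}) : E \subset Q -> q.-abelem E -> E :!=: 1 -> #|E| = q.
  move=> sEQ abE ntE; exact: cyclic_abelem_prime abE (cycE _ sEQ abE) ntE.
have ntZ1 : 'Ohm_1('Z(Q)) != 1 by rewrite Ohm1_eq1.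
have oZ : #|'Ohm_1('Z(Q))| = q.
  by apply: card_q => //; apply: Ohm1_abelem qZ (center_abelian Q).
suffices ->: 'Ohm_1(Q) = 'Ohm_1('Z(Q)) by [].
apply/eqP; rewrite eqEsubset (OhmS 1 (center_sub Q)) andbT.
rewrite (OhmE 1 qQ) gen_subG; apply/subsetP=> x; rewrite !inE => /andP[Qx xq].
pose X := (<[x]> <*> 'Ohm_1('Z(Q)))%G.
have sxQ : <[x]> \subset Q by rewrite cycle_subG.
have sXQ : X \subset Q by rewrite join_subG sxQ.
have abX : abelian X.
  have cZx : 'Ohm_1('Z(Q)) \subset 'C(<[x]>).
    by apply: centSS (Ohm_sub 1 'Z(Q)) sxQ _; apply: subsetIr.
  by rewrite abelianY cycle_abelian (abelianS (Ohm_sub _ _) (center_abelian Q)) ?cZx.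
have qX := pgroupS sXQ qQ.
have sZX : 'Ohm_1('Z(Q)) \subset 'Ohm_1(X).
  by rewrite -{1}(Ohm_id 1 'Z(Q)) OhmS ?joing_subr.
have oX : #|'Ohm_1(X)| = q.
  apply: card_q; first exact: subset_trans (Ohm_sub 1 X) sXQ.
    exact: Ohm1_abelem.
  by apply: contraNneq ntZ1 => X1; rewrite -subG1 -X1.
have eqZX : 'Ohm_1('Z(Q)) = 'Ohm_1(X) by apply/eqP; rewrite eqEcard sZX oZ oX /=.
suffices: x \in 'Ohm_1(X) by rewrite -eqZX.
rewrite (OhmE 1 qX) mem_gen // !inE xq andbT.
by rewrite -cycle_subG joing_subl.
Qed.

(** If [b] had no fixed points on [D], then [D] would centralize [F] by [regular_cent], against
    regularity. A fixed [x] of order [q] gives the product [x * b]. *)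
Lemma regular_pgroup_commuting (gT : finGroupType) (F D : {group gT}) (b : gT) (q r : nat) :
    solvable F -> F :!=: 1 -> q.-group D -> D :!=: 1 -> D \subset 'N(F) ->
    b \in 'N(F) -> b \in 'N(D) -> #[b] = r -> prime r -> q != r ->
    coprime #|F| q -> coprime #|F| r ->
    (forall x, x \in D -> #[x] = q -> 'C_F[x] = 1) -> 'C_F[b] = 1 ->
  exists2 x, x \in D <*> <[b]> & #[x] = (q * r)%N.
Proof.
move=> solF ntF qD ntD nFD nFb nDb ob pr_r neq_qr coFq coFr regD regb.
have [pr_q qdvD [e oD]] := pgroup_pdiv qD ntD.
have [regDb | ntDb] := eqVneq 'C_D[b] 1.
  have cDF : D \subset 'C(F).
    apply: (@regular_cent _ F D b); rewrite ?ob //.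
    by rewrite oD coprimeXr.
  have [x Dx ox] := Cauchy pr_q qdvD; case/negP: ntF; rewrite -subG1 -(regD x) //.
  by rewrite subsetI subxx sub_cent1 (subsetP cDF).
have qC : q.-group 'C_D[b] := pgroupS (subsetIl _ _) qD.
have [_ qdvC _] := pgroup_pdiv qC ntDb.
have [x /setIP[Dx /cent1P cbx] ox] := Cauchy pr_q qdvC.
exists (x * b).
  have sD := subsetP (joing_subl D <[b]>); have sB := subsetP (joing_subr D <[b]>).
  exact: groupM (sD x Dx) (sB b (cycle_id b)).
by rewrite orderM ?ox ?ob // prime_coprime // dvdn_prime2.
Qed.

(** In a Hall subgroup [B] for the two primes, some ['O_s(B)] is nontrivial. An element of the other
    prime order normalizes it, and [regular_pgroup_commuting] applies to their action on ['F(H)]. *)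
Lemma regular_primes_adjacent (gT : finGroupType) (H : {group gT}) (q r : nat) :
    solvable H -> prime q -> prime r -> q != r -> q %| #|H| -> r %| #|H| ->
    'F(H) != 1 -> coprime #|'F(H)| q -> coprime #|'F(H)| r ->
    (forall x, x \in H -> (#[x] == q) || (#[x] == r) -> 'C_('F(H))[x] = 1) ->
  exists2 x, x \in H & #[x] = (q * r)%N.
Proof.
move=> solH pr_q pr_r neq_qr qH rH ntF coFq coFr regF.
pose pi : nat_pred := pred2 q r.
have [B hallB] := Hall_exists pi solH; have [sBH piB _] := and3P hallB.
have dvdB s : prime s -> s \in pi -> s %| #|H| -> s %| #|B|.
  move=> pr_s pi_s sH.
  have [x Hx ox] := Cauchy pr_s sH; have sxH : <[x]> \subset H by rewrite cycle_subG.
  have sx : s.-group <[x]> by rewrite /pgroup -orderE ox pnat_id.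
  have [h _ /cardSg] := Hall_psubJ hallB pi_s sxH sx.
  by rewrite -orderE ox cardJg.
have ntB : B :!=: 1.
  by apply: contraTneq (dvdB q pr_q (predU1l _ erefl) qH) => ->; rewrite cards1 Euclid_dvd1.
have solB := solvableS sBH solH.
have ntFB : 'F(B) != 1.
  apply: contra ntB => /eqP FB1; rewrite -subG1 -FB1 /=.
  apply: subset_trans (solvable_cent_Fitting solB).
  by rewrite FB1 subsetI subxx cents1.
have [|[s pr_s sF]] := trivgVpdiv 'F(B)%G; first by move=> FB1; case/eqP: ntFB.
have ntO : 'O_s(B) != 1.
  rewrite -p_core_Fitting -cardG_gt1 (card_Hall (nilpotent_pcore_Hall s (Fitting_nil B))).
  by rewrite p_part_gt1 mem_primes pr_s cardG_gt0.
have nOB : B \subset 'N('O_s(B)) := gFnorm _ _.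
have nFH : H \subset 'N('F(H)) := gFnorm _ _.
have sOH : 'O_s(B) \subset H := subset_trans (pcore_sub _ _) sBH.
have: s \in pi by apply: (pgroupP piB) => //; apply: dvdn_trans sF (cardSg (Fitting_sub B)).
have solF : solvable 'F(H) := solvableS (Fitting_sub H) solH.
have main t : prime t -> t %| #|B| -> s != t -> coprime #|'F(H)| s -> coprime #|'F(H)| t ->
  (forall x, x \in H -> (#[x] == s) || (#[x] == t) -> 'C_('F(H))[x] = 1) ->
  exists2 x, x \in H & #[x] = (s * t)%N.
- move=> pr_t tB neq_st coFs coFt regst; have [b Bb ob] := Cauchy pr_t tB.
  have Hb := subsetP sBH b Bb.
  have [] := @regular_pgroup_commuting _ 'F(H)%G 'O_s(B)%G b s t; rewrite ?pcore_pgroup //.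
  + exact: subset_trans nFH.
  + exact: (subsetP nFH).
  + exact: (subsetP nOB).
  + by move=> x Ox ox; rewrite regst ?ox ?eqxx // (subsetP sOH).
  + by rewrite regst // ob eqxx orbT.
  move=> x Dx ox; exists x => //; apply: subsetP Dx.
  by rewrite join_subG sOH cycle_subG.
case/pred2P=> defs; rewrite {s}defs in pr_s sF ntO nOB sOH main.
  by apply: main => //; apply: dvdB => //; rewrite !inE eqxx ?orbT.
rewrite mulnC; apply: main => //; first by apply: dvdB => //; rewrite !inE eqxx.
  by rewrite eq_sym.
by move=> x Hx; rewrite orbC; apply: regF.
Qed.

(** The [sigma^']-part of any preimage maps to [xb] and keeps its order modulo the [sigma]-group
    [N]. *)
Lemma quotient_order_lift (gT : finGroupType) (G N : {group gT}) (sigma : nat_pred) xb :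
    N <| G -> sigma.-group N -> xb \in G / N -> sigma^'.-elt xb ->
  exists2 x, x \in G & #[x] = #[xb].
Proof.
move=> nsNG sigmaN /morphimP[x Nx Gx ->] sigma'x.
exists x.`_(sigma^'); first by rewrite groupX.
have Nxs : x.`_(sigma^') \in 'N(N) by rewrite groupX.
rewrite -(order_coset_coprime Nxs); last first.
  exact: pnat_coprime sigmaN (p_elt_constt _ _).
by rewrite -[coset N _]/(coset_morphism N _) morph_constt // constt_p_elt.
Qed.

Lemma quotient_pgroup_lift (gT : finGroupType) (G N : {group gT}) (q : nat)
    (E : {group coset_of N}) :
    N <| G -> q^'.-group N -> E \subset G / N -> q.-group E ->
  exists Q : {group gT}, [/\ Q \subset G, q.-group Q & Q \isog E].
Proof.
move=> nsNG q'N sEG qE; have [D defE sND sDG] := inv_quotientS nsNG sEG.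
have [Q sylQ] := Sylow_exists q D; have [sQD qQ _] := and3P sylQ.
have sQG := subset_trans sQD sDG.
have nNQ : Q \subset 'N(N) := subset_trans sQG (normal_norm nsNG).
exists Q; split=> //.
have <- : Q / N = E.
  apply: (pHall_id (pi := q)) => //.
  by rewrite /= defE quotient_pHall.
by apply: quotient_isog => //; rewrite coprime_TIg // coprime_sym (pnat_coprime qQ).
Qed.

(** * A characterization of the symmetric group of degree 4 *)

Section SymmetricAction.

Variables (aT : finGroupType) (sT : finType) (to : {action aT &-> sT}).
Variables (E : {group aT}) (S : {set sT}).
Hypothesis actsE : [acts E, on S | to].

Let act_spec (x : aT) (s : 'S_#|S|) := [forall i, enum_val (s i) == to (enum_val i) x].

(** The default 1 is taken only when [x] induces no permutation of [S], which does not happen inside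
    [E]. *)
Definition act_on_Sym (x : aT) : 'S_#|S| := odflt 1 [pick s | act_spec x s].

Lemma act_on_SymE x i : x \in E -> enum_val (act_on_Sym x i) = to (enum_val i) x.
Proof.
move=> Ex; rewrite /act_on_Sym; case: pickP => [s /forallP/(_ i)/eqP // | no_s].
have toS (j : 'I_#|S|) : to (enum_val j) x \in S by rewrite (acts_act actsE Ex) enum_valP.
pose f (j : 'I_#|S|) := enum_rank_in (toS i) (to (enum_val j) x).
have fK j : enum_val (f j) = to (enum_val j) x by rewrite /f enum_rankK_in.
have inj_f : injective f.
  by move=> j k /(congr1 enum_val); rewrite !fK => /act_inj/enum_val_inj.
have /forallP[] := negbT (no_s (perm inj_f)).
by move=> j; rewrite permE fK.
Qed.

Lemma act_on_SymM : {in E &, {morph act_on_Sym : x y / x * y}}.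
Proof.
move=> x y Ex Ey; apply/permP=> i; apply: enum_val_inj.
by rewrite permM !act_on_SymE ?groupM // actM.
Qed.

Canonical act_on_Sym_morphism := Morphism act_on_SymM.

Lemma acts_faithful_isog_Sym : 'C_E(S | to) = 1 -> #|E| = #|S|`! -> E \isog [set: 'S_#|S|].
Proof.
move=> faithfulE oE; have injf : 'injm act_on_Sym_morphism.
  apply/injmP=> x y Ex Ey /= eq_xy; apply/eqP; rewrite eq_mulgV1.
  have: x * y^-1 \in 'C_E(S | to).
    rewrite inE groupM ?groupV //=; apply/astabP=> a Sa.
    rewrite -(enum_rankK_in Sa Sa) actM -act_on_SymE // eq_xy act_on_SymE //.
    by rewrite -actM mulgV act1.
  by rewrite faithfulE => /set1P->.
apply/isogP; exists act_on_Sym_morphism => //.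
by apply/eqP; rewrite eqEcard subsetT card_injm //= oE cardsT card_Sn leqnn.
Qed.

End SymmetricAction.

(** [E] acts by conjugation on its four Sylow 3-subgroups. The kernel [N] normalizes [P], so it
    meets [V] trivially; it then centralizes [V], lies in [V], and is trivial. *)
Lemma isog_Sym4 (gT : finGroupType) (E V : {group gT}) :
    #|E| = 24 -> V <| E -> #|V| = 4 -> 'C_E(V) \subset V ->
  E \isog [set: 'S_4].
Proof.
move=> oE nsVE oV cEV; have [sVE nVE] := andP nsVE.
have [P sylP] := Sylow_exists 3 E; have [sPE p3P _] := and3P sylP.
have oP : #|P| = 3 by rewrite (card_Hall sylP) oE p_part.
have coVP : coprime #|V| #|P| by rewrite oV oP.
have nVP := subset_trans sPE nVE.
have ncVP : ~~ (P \subset 'C(V)).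
  apply/negP=> cVP; have: P \subset V by rewrite (subset_trans _ cEV) // subsetI sPE.
  by move/cardSg; rewrite oP oV.
have TIVP (N : {group gT}) : N \subset V -> N \subset 'N(P) -> P \subset 'N(N) -> N \subset 'C(P).
  move=> sNV nPN nNP; apply/commG1P/trivgP; rewrite -(coprime_TIg coVP) subsetI.
  by rewrite commg_subr nPN andbT (subset_trans _ sNV) // commg_subl.
(* A nontrivial ['C_V(P)] leaves at most two other elements in [V]; since [P] has order 3, its
   orbits on them are singletons. *)
have regVP : 'C_V(P) = 1.
  apply: contraNeq ncVP => ntC; rewrite centsC.
  have nCP : P \subset 'N('C_V(P)) by rewrite normsI ?norms_cent ?normG.
  have C_gt1 : 1 < #|'C_V(P)| by rewrite cardG_gt1.
  apply/subsetP=> v Vv; have [Cv | C'v] := boolP (v \in 'C_V(P)).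
    by case/setIP: Cv.
  have dvd_vP : #|P : 'C_P[v]| %| 3 by rewrite -oP dvdn_indexg.
  have le_vP : #|P : 'C_P[v]| <= 2.
    rewrite index_cent1; have: v ^: P \subset V :\: 'C_V(P).
      apply/subsetP=> _ /imsetP[x Px ->].
      by rewrite inE !memJ_norm ?(subsetP nVP) ?(subsetP nCP) // C'v.
    move/subset_leq_card; rewrite cardsD (setIidPr (subsetIl V 'C(P))) oV => le_vP.
    apply: leq_trans le_vP _; rewrite leq_subLR.
    by case: #|_| C_gt1 => [|[|n]] // _; rewrite addn2.
  have: #|P : 'C_P[v]| == 1%N.
    by case: (primeP (isT : prime 3)) => _ /(_ _ dvd_vP)/orP[] // /eqP vP3; rewrite vP3 in le_vP.
  by rewrite indexg_eq1 subsetI subxx sub_cent1.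
(* The divisors of 24 congruent to 1 modulo 3 are 1 and 4; a normal [P] would centralize [V]. *)
have Syl4 : #|'Syl_3(E)| = 4.
  have n3_24: #|'Syl_3(E)| %| 24 by rewrite -oE card_Syl_dvd.
  have n3_mod := card_Syl_mod E (isT : prime 3).
  have n3_neq1 : #|'Syl_3(E)| != 1%N.
    apply: contra ncVP => /normal_sylowP[Q sylQ nsQE].
    have [x Ex defP] := Sylow_trans sylQ sylP.
    have nPE : E \subset 'N(P) by rewrite defP (normsP (normal_norm nsQE) x Ex) normal_norm.
    by rewrite centsC TIVP // (subset_trans sVE).
  have := dvdn_leq (isT : 0 < 24) n3_24.
  by move: #|_| n3_24 n3_mod n3_neq1; do 25![case=> //].
have actsE : [acts E, on 'Syl_3(E) | 'JG] := atrans_acts (Syl_trans 3 E).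
rewrite -Syl4; apply: (acts_faithful_isog_Sym actsE); last by rewrite oE Syl4.
set N := 'C_E(_ | _); have nNE : E \subset 'N(N).
  by rewrite normsI ?normG // (subset_trans actsE) // astab_norm.
have sNE : N \subset E := subsetIl _ _.
have nPN : N \subset 'N(P).
  apply/subsetP=> x /setIP[_ /astabP fixS]; apply/normP.
  have: P \in 'Syl_3(E) by rewrite inE.
  by move/fixS/(congr1 (@gval gT)).
have NV1 : N :&: V = 1.
  apply/trivgP; rewrite -regVP subsetI subsetIr TIVP ?subsetIr //.
    by rewrite (subset_trans (subsetIl _ _)).
  by rewrite normsI // (subset_trans sPE).
apply/trivgP; rewrite -NV1 subsetI subxx (subset_trans _ cEV) // subsetI sNE.
apply/commG1P/trivgP; rewrite -NV1 subsetI commg_subl commg_subr (subset_trans sVE) //.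
by rewrite (subset_trans sNE).
Qed.

(** * Fitting subgroups of rank one *)

Lemma cyclic_der1_cent (gT : finGroupType) (A H : {group gT}) :
  cyclic A -> H \subset 'N(A) -> H^`(1) \subset 'C(A).
Proof.
move=> cycA nAH; rewrite -ker_conj_aut ker_trivg_morphim (subset_trans (der_sub 1 H)) //=.
rewrite morphim_der // subG1; apply/eqP/derG1P.
exact: abelianS (Aut_conj_aut _ _) (Aut_cyclic_abelian cycA).
Qed.

(** The automorphism group of a cyclic 2-group is a 2-group. *)
Lemma cyclic_pgroup_p'elt_cent (gT : finGroupType) (X : {group gT}) x :
  cyclic X -> 2.-group X -> x \in 'N(X) -> 2^'.-elt x -> x \in 'C(X).
Proof.
move=> cycX twoX nXx odd_x; have sxN : <[x]> \subset 'N(X) by rewrite cycle_subG.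
rewrite -cycle_subG /= -ker_conj_aut ker_trivg_morphim sxN /=.
have odd_im : 2^'.-group (conj_aut X @* <[x]>) by apply: morphim_pgroup.
have twoA : 2.-group (Aut X).
  rewrite /pgroup (card_Aut_cyclic cycX) (card_pgroup twoX).
  case: (logn _ _) => [|k]; first by rewrite expn0.
  by rewrite totient_pfactor // mul1n pnatX pnat_id.
have := Aut_conj_aut X <[x]>; move/setIidPl=> <-.
by rewrite coprime_TIg // coprime_sym (pnat_coprime twoA).
Qed.

Lemma index2_p'elt_cent (gT : finGroupType) (R X : {group gT}) x :
    2.-group R -> X <| R -> #|R : X| = 2 -> cyclic X -> x \in 'N(R) -> x \in 'N(X) ->
    2^'.-elt x -> x \in 'C(R).
Proof.
move=> twoR nsXR iXR cycX nRx nXx odd_x; have [sXR nXR] := andP nsXR.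
have cqR : #|R / X| = 2 by rewrite card_quotient.
have [sxR sxX] : <[x]> \subset 'N(R) /\ <[x]> \subset 'N(X) by rewrite !cycle_subG.
rewrite -cycle_subG; apply: (coprime_cent_quotient nsXR) => //.
- exact: pnat_coprime twoR odd_x.
- exact: pgroup_sol twoR.
- by rewrite cycle_subG cyclic_pgroup_p'elt_cent // (pgroupS sXR).
rewrite quotient_cycle // cycle_subG cyclic_pgroup_p'elt_cent //.
- by rewrite prime_cyclic ?cqR.
- exact: quotient_pgroup.
- by rewrite -cycle_subG -quotient_cycle // quotient_norms.
exact: morph_p_elt.
Qed.

Lemma norm_order2_cent (gT : finGroupType) (Z : {group gT}) : #|Z| = 2 -> 'N(Z) \subset 'C(Z).
Proof.
move=> oZ; apply/subsetP=> x nZx; apply/centP=> z Zz; apply/commute_sym/commgP/conjg_fixP.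
have [-> | ntz] := eqVneq z 1; first by rewrite conj1g.
apply/eqP/contraT=> neq_zx.
have: [set 1; z; z ^ x] \subset Z by rewrite !subUset !sub1set group1 Zz memJ_norm.
  move/subset_leq_card; rewrite oZ setUC cardsU1 cards2 !inE conjg_eq1.
  by rewrite (negPf ntz) (negPf neq_zx) eq_sym ntz.
Qed.

(** Every order below 6 is a prime power. *)
Lemma small_group_nil (gT : finGroupType) (G : {group gT}) : #|G| < 6 -> nilpotent G.
Proof.
move=> G6; have [p pG] : exists p : nat, p.-group G.
  by case oG: #|G| (cardG_gt0 G) G6 => [|[|[|[|[|[|n]]]]]] // _ _;
    [exists 2 | exists 2 | exists 3 | exists 2 | exists 5]; rewrite /pgroup oG.
exact: pgroup_nil pG.
Qed.

(** One step beyond what [H / D] needs, the lower central term of [H] lies in [D] and also in the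
    derived subgroup of [H], hence in [D :&: C]. *)
Lemma nilpotent_quotient_metabelian (gT : finGroupType) (H A C D : {group gT}) :
    A <| H -> D <| H -> H^`(1) \subset C -> D :&: C \subset A -> nilpotent (H / D) ->
  nilpotent (H / A).
Proof.
move=> nsAH nsDH sHC sDCA /lcnP[n Ln1]; apply/lcnP; exists n.+1.
have [nAH nDH] := (normal_norm nsAH, normal_norm nsDH).
rewrite -morphim_lcn //; apply/trivgP; rewrite quotient_sub1; last first.
  by rewrite (subset_trans (lcn_sub _ _)).
rewrite (subset_trans _ sDCA) // subsetI; apply/andP; split.
  rewrite (subset_trans (lcn_subS _ _)) //.
  rewrite -quotient_sub1; last by rewrite (subset_trans (lcn_sub _ _)).
  by rewrite /quotient morphim_lcn // -/(quotient _ _) Ln1.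
by apply: subset_trans sHC; rewrite /= lcnSn derg1 commSg ?lcn_sub.
Qed.

Section RankOneFitting.

Variables (gT : finGroupType) (H : {group gT}).
Hypothesis solH : solvable H.
Hypothesis rank1 : forall (q : nat) (E : {group gT}),
  q \in \pi('F(H)) -> E \subset H -> q.-abelem E -> cyclic E.
Hypothesis nnilHA : ~~ nilpotent (H / 'F(H)).

(** [C] and [K2] are the kernels of the action of [H] on the odd part [A'] and the 2-part [A2] of
    its Fitting subgroup. [D] consists of the elements inducing inner automorphisms on [A2], so
    [H / D] embeds in the outer automorphism group of [A2]. *)
Let A := 'F(H)%G.
Let A2 := 'O_2(A)%G.
Let A' := 'O_2^'(A)%G.
Let C := 'C_H(A')%G.
Let K2 := 'C_H(A2)%G.
Let D := (A2 <*> K2)%G.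
Let nsAH : A <| H := Fitting_normal H.
Let nsA2H : A2 <| H := gFnormal_trans _ nsAH.
Let nsA'H : A' <| H := gFnormal_trans _ nsAH.
Let nA2H : H \subset 'N(A2) := normal_norm nsA2H.
Let sA2H : A2 \subset H := normal_sub nsA2H.
Let twoA2 : 2.-group A2 := pcore_pgroup 2 A.

Lemma rank1_pgroup_cases (q : nat) (Q : {group gT}) :
    q \in \pi(A) -> Q \subset H -> q.-group Q -> Q :!=: 1 ->
  cyclic Q || (q == 2) && (extremal_class Q == Quaternion).
Proof.
move=> piq sQH qQ ntQ; apply/(prime_Ohm1P qQ ntQ)/abelem_cyclic_Ohm1 => // E sEQ abE.
by apply: (rank1 piq) abE; apply: subset_trans sQH.
Qed.

(** Its Sylow subgroups are cyclic, the quaternion case being confined to the prime 2, and a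
    nilpotent group with cyclic Sylow subgroups is cyclic. *)
Lemma odd_Fitting_cyclic : cyclic A'.
Proof.
apply: nil_Zgroup_cyclic; last exact: nilpotentS (pcore_sub _ _) (Fitting_nil H).
apply/forall_inP=> V /SylowP[r pr_r sylV]; have [sVA' rV _] := and3P sylV.
have [-> | ntV] := eqsVneq V 1; first exact: cyclic1.
have sVA := subset_trans sVA' (pcore_sub _ _).
have [_ rdvV _] := pgroup_pdiv rV ntV.
have pi_r : r \in \pi(A).
  by rewrite mem_primes pr_r cardG_gt0 (dvdn_trans rdvV) ?cardSg.
have sVH := subset_trans sVA (normal_sub nsAH).
have /orP[// | /andP[/eqP r2 _]] := rank1_pgroup_cases pi_r sVH rV ntV.
have := pgroupP (pgroupS sVA' (pcore_pgroup _ _)) _ pr_r rdvV.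
by rewrite r2.
Qed.

Lemma der1_sub_cent_odd : H^`(1) \subset C.
Proof.
by rewrite subsetI der_sub (cyclic_der1_cent odd_Fitting_cyclic) ?(normal_norm nsA'H).
Qed.

Let nsK2H : K2 <| H.
Proof. by rewrite /normal subsetIl normsI ?normG ?norms_cent. Qed.

Let nsDH : D <| H.
Proof. exact: normalY. Qed.

Let defD : D = A2 * K2 :> {set gT}.
Proof. by rewrite /= norm_joinEr // (subset_trans (subsetIl _ _)). Qed.

(** By the modular law [D :&: C] is [A2] times [K2 :&: C], and the latter centralizes all of [A]. *)
Lemma setI_join_cent_odd : D :&: C \subset A.
Proof.
have [_ eA cA2A' _] := dprodP (nilpotent_pcoreC 2 (Fitting_nil H)).
have sA2C : A2 \subset C by rewrite subsetI sA2H centsC.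
rewrite defD -group_modl // mul_subG ?pcore_sub //.
apply: subset_trans (solvable_cent_Fitting solH).
apply/subsetP=> x /setIP[/setIP[Hx cx2] /setIP[_ cx']].
by rewrite inE Hx /= -[X in 'C(X)]eA centM inE cx2.
Qed.

Lemma join_cent_not_nil : ~~ nilpotent (H / D).
Proof.
apply: contra nnilHA => nilHD.
exact: nilpotent_quotient_metabelian nsAH nsDH der1_sub_cent_odd setI_join_cent_odd nilHD.
Qed.

(** Otherwise all elements of odd order lie in [K2], and [H / D] is a 2-group, hence nilpotent. *)
Lemma odd_elt_not_cent : exists x, [/\ x \in H, 2^'.-elt x & x \notin 'C(A2)].
Proof.
have [/existsP[x /and3P[]] | no_x] :=
  boolP [exists x, [&& x \in H, 2^'.-elt x & x \notin 'C(A2)]].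
  by exists x.
case/negP: join_cent_not_nil; apply: (@pgroup_nil _ 2).
apply/pgroupP=> r pr_r rHD; rewrite inE; apply: contraT => r2.
have [xb /morphimP[x Nx Hx ->] ox] := Cauchy pr_r rHD.
have odd_xb : 2^'.-elt (coset D x) by rewrite /p_elt ox pnatE.
have cx : x.`_(2^') \in 'C(A2).
  apply: contraR no_x => ncx; apply/existsP; exists x.`_(2^').
  by rewrite groupX // p_elt_constt.
have Dx : x.`_(2^') \in D by rewrite (subsetP (joing_subr A2 K2)) // inE groupX.
have := @morph_constt _ _ _ (coset_morphism D) (2^') x Nx.
rewrite /= (constt_p_elt odd_xb) coset_id // => xb1.
by move: pr_r; rewrite -ox /= -xb1 order1.
Qed.

(** An element of odd order normalizing a 2-group that is cyclic, or quaternion of order above 8,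
    centralizes it; yet some such element does not centralize [A2]. *)
Lemma Fitting_2core_quaternion : [/\ 2 \in \pi(A), #|A2| = 8 & extremal_class A2 = Quaternion].
Proof.
have [x [Hx odd_x ncx]] := odd_elt_not_cent.
have nA2x := subsetP nA2H x Hx.
have ncyc : ~~ cyclic A2 by apply: contra ncx => cyc; apply: cyclic_pgroup_p'elt_cent.
have ntA2 : A2 :!=: 1 by apply: contraNneq ncyc => ->; apply: cyclic1.
have [_ dvA2 _] := pgroup_pdiv twoA2 ntA2.
have pi2 : 2 \in \pi(A).
  by rewrite mem_primes cardG_gt0 (dvdn_trans dvA2) // cardSg ?pcore_sub.
have := rank1_pgroup_cases pi2 sA2H twoA2 ntA2; rewrite (negPf ncyc) /= => /eqP clA2.
split=> //; have /quaternion_classP[n n_gt2 isoA2] := clA2.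
have oA2 : #|A2| = (2 ^ n)%N by rewrite (card_isog isoA2) card_quaternion.
have [n_gt3 | n_le3] := ltnP 3 n; last first.
  by rewrite oA2 (_ : n = 3) //; apply/eqP; rewrite eqn_leq n_le3.
have [[u v] genA2 _] := generators_quaternion n_gt2 isoA2.
have [_ _ _ _ /(_ n_gt3)[_ _ uniqX]] := quaternion_structure n_gt2 genA2 isoA2.
have [oA Au ou _] := genA2; have sUA : <[u]> \subset A2 by rewrite cycle_subG.
have iU : #|A2 : <[u]>| = 2.
  rewrite -divgS // oA -orderE ou -{1}(prednK (ltnW (ltnW n_gt2))) expnS mulnK //.
  by rewrite expn_gt0.
(* [<[u]>] is the only cyclic subgroup of index 2 in [A2], so [x] normalizes it. *)
case/negP: ncx; apply: (@index2_p'elt_cent _ A2 <[u]>%G) => //; first 1 last.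
- exact: cycle_cyclic.
- apply/normP; apply: uniqX; first by rewrite cyclicJ cycle_cyclic.
    by rewrite -(normP nA2x) conjSg.
  by rewrite -{1}(normP nA2x) indexJg.
by rewrite /normal sUA (normal_norm (index2_normal sUA iU)).
Qed.

Lemma Fitting_2core_generators : exists u, exists v,
  [/\ u \in A2, #[u] = 4, v \in A2 :\: <[u]>, <[u]> * <[v]> = A2 & #|'Z(A2)| = 2].
Proof.
have [_ o8 /quaternion_classP[n n_gt2 isoA2]] := Fitting_2core_quaternion.
have n3 : n = 3.
  apply/eqP; rewrite -(eqn_exp2l _ _ (isT : 1 < 2)).
  by rewrite -(card_quaternion n_gt2) -(card_isog isoA2) o8.
rewrite {n}n3 in n_gt2 isoA2.
have [[u v] genA2 _] := generators_quaternion n_gt2 isoA2.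
have [_ _ [_ oZ _ _ _] _ _] := quaternion_structure n_gt2 genA2 isoA2.
have [_ _ _ defUV _] := extremal_generators_facts (isT : prime 2) genA2.
have [_ Au ou Uv] := genA2; exists u, v; split=> //.
Qed.

(* [K2 = C_H(u) :&: C(v)] for generators [u], [v] of the quaternion group [A2] of order
   8; the classes of [u] in [H] and of [v] in [C_H(u)] bound the index from above,
   and [H / D] is too large to be nilpotent. *)
Lemma cent_Fitting_2core_index : #|H : D| = 6 /\ #|H : K2| = 24.
Proof.
have [_ o8 _] := Fitting_2core_quaternion.
have [u [v [Au ou /setDP[Av Uv] genA2 oZ]]] := Fitting_2core_generators.
have sC2 : 'C_H[u] :&: 'C[v] = K2.
  by rewrite /= -setIA -genA2 centM !cent_cycle.
have iu : #|H : 'C_H[u]| <= 6.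
  rewrite index_cent1; have: u ^: H \subset A2 :\: 'Z(A2).
    apply/subsetP=> _ /imsetP[x Hx ->]; rewrite inE.
    rewrite !memJ_norm ?(subsetP nA2H) ?(subsetP (char_norm_trans (center_char _) nA2H)) //.
    rewrite Au andbT; apply/negP=> Zu; have := order_dvdG Zu; by rewrite oZ ou.
  by move/subset_leq_card; rewrite cardsD (setIidPr (center_sub A2)) oZ o8.
have iv : #|'C_H[u] : 'C_H[u] :&: 'C[v]| <= 4.
  rewrite index_cent1; have: v ^: 'C_H[u] \subset A2 :\: <[u]>.
    apply/subsetP=> _ /imsetP[x /setIP[Hx cxu] ->]; rewrite inE.
    rewrite !memJ_norm ?(subsetP nA2H) ?Av ?Uv //.
    by rewrite (subsetP (cent_sub _)) // cent_cycle.
  move/subset_leq_card; rewrite cardsD.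
  have sUA : <[u]> \subset A2 by rewrite cycle_subG.
  by rewrite (setIidPr sUA) -orderE ou o8.
have le24 : #|H : K2| <= 24.
  rewrite -sC2 -(Lagrange_index (subsetIl H 'C[u]) (subsetIl _ _)).
  exact: leq_mul iu iv.
have iD : #|D : K2| = 4.
  have sK2D : K2 \subset D := joing_subr _ _.
  have oAK : #|A2 :&: K2| = 2 by rewrite /= setIA (setIidPl sA2H).
  have := mul_cardG A2 K2; rewrite -defD oAK o8 -(Lagrange sK2D) mulnC -mulnA => /eqP.
  rewrite eqn_pmul2l ?cardG_gt0 // -[8]/(4 * 2)%N eqn_pmul2r // => /eqP.
  by move->.
(* Groups of order below 6 are nilpotent. Since [#|D : K2|] is 4, this lower bound meets the upper
   bound 24. *)
have leD : 6 <= #|H : D|.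
  rewrite -card_quotient ?normal_norm // leqNgt.
  by apply: contra join_cent_not_nil; apply: small_group_nil.
have eqH : (#|H : D| * 4)%N = #|H : K2|.
  by rewrite -iD Lagrange_index ?joing_subr ?normal_sub.
move: le24; rewrite -eqH => le24.
have -> : #|H : D| = 6 by apply/eqP; rewrite eqn_leq leD andbT -(leq_pmul2r (isT : 0 < 4)).
by [].
Qed.

(** A group of order 6 is metabelian, which puts the second derived subgroup in [D]; it also lies in
    [C]. *)
Lemma quotient_Fitting_metabelian : H^`(2) \subset A.
Proof.
have [iD _] := cent_Fitting_2core_index.
apply: subset_trans setI_join_cent_odd; rewrite subsetI; apply/andP; split; last first.
  exact: subset_trans (der_sub 1 _) der1_sub_cent_odd.
have nDH := normal_norm nsDH.
rewrite -quotient_sub1; last by rewrite (subset_trans (der_sub 2 H)).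
rewrite /quotient morphim_der //= -/(quotient _ _) subG1; apply/eqP/derG1P.
have oHD : #|H / D| = 6 by rewrite card_quotient.
have ntHD : H / D != 1 by rewrite -cardG_gt1 oHD.
have ltHD := sol_der1_proper (quotient_sol D solH) (subxx _) ntHD.
have dvd6 : #|(H / D)^`(1)| %| 6 by rewrite -oHD cardSg ?der_sub.
have lt6 : #|(H / D)^`(1)| < 6 by rewrite -oHD proper_card.
have: #|(H / D)^`(1)| \in [:: 1; 2; 3]%N.
  by move: #|_| dvd6 lt6; do 7![case=> //].
rewrite !inE => /or3P[/eqP/card1_trivg-> | /eqP o2 | /eqP o3]; first exact: abelian1.
  by apply: cyclic_abelian; rewrite prime_cyclic ?o2.
by apply: cyclic_abelian; rewrite prime_cyclic ?o3.
Qed.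

(** If [x] in [T] centralizes [A2], then [u] and [x] generate an abelian 2-group, cyclic by [rank1].
    There either [x] is a power of [u], hence in [A2], or [u] is a power of [x], hence central in
    [A2], although its order is 4. *)
Lemma cent_Fitting_2core_Sylow (T : {group gT}) :
  2.-Sylow(H) T -> A2 \subset T /\ #|'C_T(A2)| = 2.
Proof.
move=> sylT; have [pi2 o8 clA2] := Fitting_2core_quaternion.
have [u [v [Au ou _ _ oZ]]] := Fitting_2core_generators.
have [sTH twoT _] := and3P sylT.
have sAT : A2 \subset T.
  by rewrite /= p_core_Fitting; apply: pcore_sub_Hall sylT.
split=> //; suffices -> : 'C_T(A2) = 'Z(A2) by [].
apply/eqP; rewrite eqEsubset [X in _ && X]setSI // andbT subsetI subsetIr andbT.
apply/subsetP=> x /setIP[Tx cxA]; apply: contraT => A'x.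
pose Y := (<[u]> <*> <[x]>)%G.
have sYT : Y \subset T by rewrite join_subG !cycle_subG Tx (subsetP sAT).
have twoY := pgroupS sYT twoT.
have abY : abelian Y.
  rewrite abelianY !cycle_abelian cycle_subG /= cent_cycle; apply/cent1P.
  exact: (centP cxA).
have cycY : cyclic Y.
  have [-> | ntY] := eqsVneq Y 1; first exact: cyclic1.
  have /orP[// | /andP[_ /eqP/quaternion_classP[n n_gt2 isoY]]] :=
    rank1_pgroup_cases pi2 (subset_trans sYT sTH) twoY ntY.
  have [[u' v'] genY _] := generators_quaternion n_gt2 isoY.
  have [_ _ [_ oZY _ _ _] _ _] := quaternion_structure n_gt2 genY isoY.
  have := card_isog isoY; rewrite card_quaternion // -(center_idP abY) oZY.
  by move=> /eqP; rewrite -{1}[2]expn1 eqn_exp2l // => /eqP n1; rewrite -n1 in n_gt2.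
have [sUY sXY] : <[u]> \subset Y /\ <[x]> \subset Y by rewrite joing_subl joing_subr.
have [k ox] : exists k, #[x] = (2 ^ k)%N.
  by exists (logn 2 #[x]); rewrite [LHS](card_pgroup (pgroupS sXY twoY)).
case: (leqP k 2) => [k2 | k2].
  have: <[x]> \subset <[u]>.
    by rewrite -(cardSg_cyclic cycY) // -!orderE ou ox -[4]/(2 ^ 2)%N dvdn_Pexp2l.
  have sUA : <[u]> \subset A2 by rewrite cycle_subG.
  by rewrite cycle_subG => /(subsetP sUA) Ax; rewrite Ax in A'x.
have: <[u]> \subset <[x]>.
  by rewrite -(cardSg_cyclic cycY) // -!orderE ou ox -[4]/(2 ^ 2)%N dvdn_Pexp2l // ltnW.
rewrite cycle_subG => /cycleP[i def_u].
have Zu : u \in 'Z(A2) by rewrite inE Au def_u groupX.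
by have := order_dvdG Zu; rewrite oZ ou.
Qed.

(** The index 24 of [K2] contributes 8 and [K2] contributes 2 to the order of [T]; containing the
    quaternion [A2], [T] is not cyclic. *)
Lemma Sylow2_isog_Q16 (T : {group gT}) : 2.-Sylow(H) T -> T \isog [set: 'Q_16].
Proof.
move=> sylT; have [pi2 o8 clA2] := Fitting_2core_quaternion.
have [sAT oCT] := cent_Fitting_2core_Sylow sylT.
have [sTH twoT _] := and3P sylT; have [_ iK2] := cent_Fitting_2core_index.
have oT : #|T| = 16.
  have sylK : 2.-Sylow(K2) (K2 :&: T) := Sylow_setI_normal nsK2H sylT.
  have oK2 : (#|K2|`_2 = 2)%N.
    by rewrite -(card_Hall sylK) /= setIC setIA (setIidPl sTH).
  by rewrite (card_Hall sylT) -(Lagrange (normal_sub nsK2H)) iK2 partnM // oK2 p_part.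
have ntT : T :!=: 1 by rewrite -cardG_gt1 oT.
have /orP[cycT | /andP[_ /eqP/quaternion_classP[n n_gt2 isoT]]] :=
  rank1_pgroup_cases pi2 sTH twoT ntT.
  have /quaternion_classP[n n_gt2 isoA] := clA2.
  have [[u' v'] genY _] := generators_quaternion n_gt2 isoA.
  have [_ _ [_ oZY _ _ _] _ _] := quaternion_structure n_gt2 genY isoA.
  have cycA := cyclicS sAT cycT.
  by rewrite (center_idP (cyclic_abelian cycA)) o8 in oZY.
have n4 : n = 4.
  apply/eqP; rewrite -(eqn_exp2l _ _ (isT : 1 < 2)).
  by rewrite -(card_quaternion n_gt2) -(card_isog isoT) oT.
by rewrite n4 in isoT.
Qed.

Let K := 'O_2^'(H)%G.
Let nsKH : K <| H := pcore_normal _ _.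

(** ['Z(A2)] is a central Sylow 2-subgroup of [K2], so its Schur-Zassenhaus complement is normal and
    equals the odd core. *)
Lemma cent_Fitting_2core_decomp : K \subset K2 /\ 'Z(A2) * K = K2.
Proof.
have [u [v [Au ou _ _ oZ]]] := Fitting_2core_generators.
have [T sylT] := Sylow_exists 2 H; have [sAT oCT] := cent_Fitting_2core_Sylow sylT.
have [sTH twoT _] := and3P sylT.
have sKK2 : K \subset K2.
  rewrite subsetI pcore_sub; apply/commG1P/trivgP.
  have coKA : coprime #|K| #|A2|.
    by rewrite coprime_sym (pnat_coprime twoA2) // -/(pgroup _ _) pcore_pgroup.
  rewrite -(coprime_TIg coKA) subsetI commg_subl commg_subr.
  by rewrite (subset_trans sA2H) ?(subset_trans (pcore_sub _ _)) // normal_norm.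
split=> //.
have sylK : 2.-Sylow(K2) 'Z(A2).
  have -> : 'Z(A2) = K2 :&: T.
    rewrite /= setIC setIA (setIidPl sTH); apply/eqP.
    by rewrite eqEcard oCT oZ leqnn andbT setSI.
  exact: Sylow_setI_normal nsK2H sylT.
have sZK2 := pHall_sub sylK.
have cZK2 : K2 \subset 'C('Z(A2)) by rewrite subIset // centS ?center_sub ?orbT.
have nsZK2 : 'Z(A2) <| K2 by rewrite /normal sZK2 cents_norm.
have /splitsP[M /complP[tiZM defK2]] := SchurZassenhaus_split (pHall_Hall sylK) nsZK2.
have sMK2 : M \subset K2 by rewrite -defK2 mulG_subr.
have sylM : 2^'.-Hall(K2) M.
  by rewrite -(compl_pHall M sylK); apply/complP.
have nsMK2 : M <| K2.
  rewrite /normal sMK2 -defK2 mulG_subG normG andbT cents_norm //.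
  by rewrite centsC (subset_trans sMK2).
have defM : 'O_2^'(K2) = M := normal_Hall_pcore sylM nsMK2.
suffices -> : K = M :> {set gT} by [].
apply/eqP; rewrite eqEsubset -{1 2}defM; apply/andP; split.
  rewrite pcore_max ?pcore_pgroup //.
  by rewrite /normal sKK2 (subset_trans (normal_sub nsK2H)) // normal_norm.
by rewrite pcore_max ?pcore_pgroup // (gFnormal_trans _ nsK2H).
Qed.

Lemma quotient_cent_Fitting_2core_isog : H / K2 \isog [set: 'S_4].
Proof.
have [_ o8 _] := Fitting_2core_quaternion; have [_ iK2] := cent_Fitting_2core_index.
have [u [v [Au ou /setDP[Av _] genA2 oZ]]] := Fitting_2core_generators.
have nK2H := normal_norm nsK2H.
have nK2A : A2 \subset 'N(K2) := subset_trans sA2H nK2H.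
have sAK : A2 :&: K2 = 'Z(A2) by rewrite /= setIA (setIidPl sA2H).
have oV : #|A2 / K2| = 4.
  rewrite card_quotient // -divgI sAK o8 oZ //.
apply: (@isog_Sym4 _ (H / K2)%G (A2 / K2)%G) => //.
- by rewrite card_quotient.
- exact: quotient_normal.
have [Y defY sKY sYH] := inv_quotientS nsK2H (subsetIl (H / K2) 'C(A2 / K2)).
have nAY := subset_trans sYH nA2H; have nKY := subset_trans sYH nK2H.
have sYA : [~: A2, Y] \subset 'Z(A2).
  rewrite -sAK subsetI commg_subl nAY -quotient_cents2 //.
  by rewrite centsC -defY subsetIr.
(* [Y] moves the generators [u] and [v] only within cosets of ['Z(A2)], so [K2] has index at most 4
   in it, and [A2 / K2] is its own centralizer. *)
have orb w : w \in A2 -> #|w ^: Y| <= 2.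
  move=> Aw; have: w ^: Y \subset w *: 'Z(A2).
    apply/subsetP=> _ /imsetP[y Yy ->]; rewrite mem_lcoset -commgEl.
    by rewrite (subsetP sYA) // mem_commg.
  by move/subset_leq_card; rewrite card_lcoset oZ.
have iY : #|Y : K2| <= 4.
  have eqK : 'C_Y[u] :&: 'C[v] = K2.
    rewrite -setIA -!cent_cycle -centM genA2; apply/eqP; rewrite eqEsubset.
    by rewrite setSI // subsetI sKY subsetIr.
  rewrite -eqK -(Lagrange_index (subsetIl Y 'C[u]) (subsetIl _ _)) -[4]/(2 * 2)%N.
  apply: leq_mul; first by rewrite index_cent1 orb.
  rewrite index_cent1 (leq_trans _ (orb v Av)) // subset_leq_card //.
  exact/imsetS/subsetIl.
have abV : abelian (A2 / K2) by apply: (@card_p2group_abelian _ 2).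
have sVC : A2 / K2 \subset 'C_(H / K2)(A2 / K2) by rewrite subsetI quotientS.
suffices /eqP<- : A2 / K2 == 'C_(H / K2)(A2 / K2) by [].
by rewrite eqEcard sVC oV /= defY card_quotient.
Qed.

Theorem rank1_Fitting_exceptional :
  [/\ 2 \in \pi('F(H)), H^`(2) \subset 'F(H) & binary_octahedral (H / 'O_2^'(H))].
Proof.
have [pi2 o8 _] := Fitting_2core_quaternion; split=> //; first exact: quotient_Fitting_metabelian.
have [u [v [Au ou _ _ oZ]]] := Fitting_2core_generators.
have [sKK2 defK2] := cent_Fitting_2core_decomp.
have nKH := normal_norm nsKH.
have [T sylT] := Sylow_exists 2 H; have [sTH twoT _] := and3P sylT.
have nsZH : 'Z(A2) <| H := gFnormal_trans _ nsA2H.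
have sZH := normal_sub nsZH; have nKZ := subset_trans sZH nKH.
have tiZK : K :&: 'Z(A2) = 1.
  rewrite coprime_TIg // coprime_sym (@pnat_coprime 2) //.
    exact: pgroupS (center_sub _) twoA2.
  by rewrite -/(pgroup _ _) pcore_pgroup.
(* Modulo [K], the group ['Z(A2)] becomes [K2], so the quotient by it is [H / K2]; a normal subgroup
   of order 2 is central. *)
exists ('Z(A2) / K)%G; split.
- rewrite subsetI quotientS // quotient_cents // centsC.
  exact: subset_trans (normal_norm nsZH) (norm_order2_cent oZ).
- by rewrite -(card_isog (quotient_isog nKZ tiZK)).
- have -> : ('Z(A2) / K)%G = (K2 / K)%G.
    by apply: val_inj; rewrite /= -[in RHS]defK2 quotientMidr.
  exact: isog_trans (third_isog sKK2 nsKH nsK2H) quotient_cent_Fitting_2core_isog.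
have nKT := subset_trans sTH nKH.
exists (T / K)%G; first by rewrite inE quotient_pHall.
apply: isog_trans (Sylow2_isog_Q16 sylT); rewrite isog_sym quotient_isog //.
rewrite coprime_TIg // coprime_sym (pnat_coprime twoT) //.
by rewrite -/(pgroup _ _) pcore_pgroup.
Qed.

End RankOneFitting.

(** * Prime graph components *)

Lemma fitting_length_metabelian (gT : finGroupType) (E : {group gT}) :
  ~~ nilpotent E -> abelian E^`(1) -> fitting_length E = 2.
Proof.
move=> nnilE abE'.
have ntE : E :!=: 1 by apply: contraNneq nnilE => ->; apply: nilpotent1.
have nE1 : E \subset 'N(1) := norms1 E.
set F1 := fitting_series E 1.
have defF1 : F1 / 1 = 'F(E / 1) by rewrite cosetpreK.
have nsF1 : F1 <| E.
  by rewrite -[X in _ <| X](quotientGK (normal1 E)) cosetpre_normal Fitting_normal.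
have nF1 : (F1 == E :> {set gT}) = false.
  apply: contraNF nnilE => /eqP eF1.
  have: nilpotent (F1 / 1) by rewrite defF1 Fitting_nil.
  by rewrite eF1 -(isog_nil (quotient1_isog E)).
have sE'F1 : E^`(1) \subset F1.
  rewrite -(quotientSGK (subset_trans (der_sub 1 E) nE1)) ?sub1G // defF1.
  apply: Fitting_max; first exact: quotient_normal (der_normal 1 E).
  exact/abelian_nil/quotient_abelian.
have F2 : fitting_series E 2 = E :> {set gT}.
  have abEF : abelian (E / F1) by apply: sub_der1_abelian.
  rewrite /= -/(fitting_series E 1) -/F1.
  have -> : 'F(E / F1) = E / F1.
    by apply/eqP; rewrite eqEsubset Fitting_sub Fitting_max ?abelian_nil.
  exact: quotientGK.
(* The search range must reach the index 2, which requires [#|E|] to exceed 1. *)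
rewrite /fitting_length; case oE: #|E| (cardG_gt0 E) => [|[|n]] // _.
  by move: ntE; rewrite -cardG_gt1 oE.
have F0 : (fitting_series E 0 == E :> {set gT}) = false.
  by rewrite eq_sym; apply: negbTE.
by rewrite [iota _ _]/= [find _ _]/= F0 -/F1 nF1 -/(fitting_series E 2) F2 eqxx.
Qed.

Lemma binary_octahedral_isog (gT rT : finGroupType) (H : {group gT}) (L : {group rT}) :
  H \isog L -> binary_octahedral H -> binary_octahedral L.
Proof.
case/isogP=> f injf defL [Z [sZ oZ isoS [P sylP isoP]]].
have sZH := subset_trans sZ (center_sub H).
have nsZH : Z <| H := sub_center_normal sZ.
have sPH : P \subset H by move: sylP; rewrite inE => /pHall_sub.
exists (f @* Z)%G; split.
- by rewrite /= -defL -injm_center // morphimS.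
- by rewrite card_injm.
- apply: isog_trans isoS; rewrite isog_sym /= -defL.
  have := sub_isog (subxx (H / Z)) (injm_quotm nsZH injf).
  by rewrite morphim_quotm.
exists (f @* P)%G.
  by move: sylP; rewrite !inE -defL injm_pHall.
by apply: isog_trans isoP; rewrite isog_sym sub_isog.
Qed.

Section PrimeGraph.

Variables (gT : finGroupType) (G : {group gT}) (sigma : nat_pred).

Lemma pg_connected_refl p : pg_vert G sigma p -> pg_connected G sigma p p.
Proof. by move=> vp; split=> //; exists [::]. Qed.

Lemma pg_connected_vert p q : pg_connected G sigma p q -> pg_vert G sigma q.
Proof.
case=> vp [s [+ <-]]; elim/last_ind: s => //= s x _.
by rewrite rcons_path last_rcons => /and3P[].
Qed.

Lemma pg_connected_adj p q r :
    pg_connected G sigma p q -> pg_vert G sigma r -> pg_adj G q r ->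
  pg_connected G sigma p r.
Proof.
case=> vp [s [path_s last_s]] vr adj_qr; split=> //; exists (rcons s r).
by rewrite rcons_path last_rcons path_s last_s adj_qr vr.
Qed.

Lemma pg_adj_order p q x :
  prime p -> prime q -> p != q -> x \in G -> #[x] = (p * q)%N -> pg_adj G p q.
Proof.
move=> pr_p pr_q neq_pq Gx ox; have xG := order_dvdG Gx; rewrite ox in xG.
rewrite /pg_adj !mem_primes cardG_gt0 pr_p pr_q neq_pq (dvdn_trans _ xG) ?dvdn_mulr //.
rewrite (dvdn_trans _ xG) ?dvdn_mull //=; apply/exists_inP; exists x => //; exact/eqP.
Qed.

Lemma quotient_pcore_adj p q xb :
    prime p -> prime q -> p != q -> p \notin sigma -> q \notin sigma ->
    xb \in G / 'O_sigma(G) -> #[xb] = (p * q)%N -> pg_adj G p q.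
Proof.
move=> pr_p pr_q neq_pq s'p s'q Gxb oxb.
have [|x Gx ox] := quotient_order_lift (pcore_normal sigma G) (pcore_pgroup sigma G) Gxb.
  by rewrite /p_elt oxb pnatM !pnatE //; apply/andP.
by apply: (@pg_adj_order p q x); rewrite ?ox.
Qed.

End PrimeGraph.

Lemma pgroup_of_primes (gT : finGroupType) (X : {group gT}) (pi : nat_pred) :
  {subset \pi(X) <= pi} -> pi.-group X.
Proof. by move=> sub; apply/pgroupP=> p pr_p pX; apply: sub; rewrite mem_primes pr_p cardG_gt0. Qed.

Lemma pgroup_extension (gT : finGroupType) (N X : {group gT}) (pi : nat_pred) :
  N <| X -> pi.-group N -> pi.-group (X / N) -> pi.-group X.
Proof.
move=> /andP[sNX nNX] piN piXN; rewrite /pgroup -(Lagrange sNX) pnatM -card_quotient //.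
exact/andP.
Qed.

(** * The normal series attached to two components *)

Section TwoComponents.

Variables (gT : finGroupType) (G : {group gT}) (sigma pi1 pi2 : nat_pred).
Hypotheses (solG : solvable G) (comp1 : pg_component G sigma pi1).
Hypotheses (comp2 : pg_component G sigma pi2) (disj : ~ exists p, p \in pi1 /\ p \in pi2).
Hypothesis pi1F : {subset \pi('F(G / 'O_sigma(G))) <= pi1}.

Let G0 := ('O_sigma(G))%G.
Let Gb := (G / G0)%G.
Let F := ('F(Gb))%G.
Let nsG0 : G0 <| G := pcore_normal sigma G.
Let solGb : solvable Gb := quotient_sol G0 solG.
Let piF : pi1.-group F := pgroup_of_primes pi1F.

Lemma component_vert (pi : nat_pred) p : pg_component G sigma pi -> p \in pi -> pg_vert G sigma p.
Proof. by case=> r [_ defpi] /defpi/pg_connected_vert. Qed.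

Lemma pi1_sigma' : {subset pi1 <= sigma^'}.
Proof. by move=> p /(component_vert comp1)/andP[_]. Qed.

Lemma vert_quotient_dvd q : pg_vert G sigma q -> q %| #|Gb|.
Proof.
case/andP; rewrite mem_primes => /and3P[pr_q _ qG] s'q.
rewrite card_quotient ?normal_norm //; move: (qG : q %| #|G|).
rewrite -(Lagrange (normal_sub nsG0)) Euclid_dvdM // => /orP[qG0 | //].
by case/negP: s'q; apply: (pgroupP (pcore_pgroup sigma G)).
Qed.

(** A nontrivial [y] has a power [z] of prime order [p] in [pi1]. Then [z * b] has order [p * q],
    and lifting it to [G] makes [q] adjacent to [p], which puts [q] in [pi1]. *)
Lemma not_pi1_regular q b y :
    pg_vert G sigma q -> q \notin pi1 -> b \in Gb -> y \in Gb -> #[b] = q ->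
    pi1.-elt y -> commute b y ->
  y = 1.
Proof.
move=> vq pi1'q Gb_b Gb_y ob pi1y cby; apply: contraNeq pi1'q => nty.
have [+ s'q] := andP vq; rewrite mem_primes => /and3P[pr_q _ _].
have y_gt1 : 1 < #[y] by rewrite order_gt1.
have pr_p := pdiv_prime y_gt1; set p := pdiv #[y] in pr_p.
have pi1p : p \in pi1 by apply: (pgroupP pi1y) => //; apply: pdiv_dvd.
have [z yz oz] := Cauchy pr_p (pdiv_dvd #[y]).
have [-> // | neq_pq] := eqVneq q p.
have czb : commute z b by case/cycleP: yz => i ->; apply/commute_sym/commuteX.
have ozb : #[z * b] = (p * q)%N.
  by rewrite orderM // ?oz ?ob // prime_coprime // dvdn_prime2 // eq_sym.
have adj_pq : pg_adj G p q.
  apply: (@quotient_pcore_adj _ G sigma p q (z * b)) => //; first by rewrite eq_sym.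
    exact: pi1_sigma'.
  by rewrite groupM // (subsetP _ z yz) // cycle_subG.
have [r [_ defpi]] := comp1; apply/defpi.
exact: pg_connected_adj (iffLR (defpi p) pi1p) vq adj_pq.
Qed.

Lemma not_pi1_cent1_Fitting q x :
  pg_vert G sigma q -> q \notin pi1 -> x \in Gb -> #[x] = q -> 'C_F[x] = 1.
Proof.
move=> vq pi1'q Gx ox; apply/trivgP/subsetP=> y /setIP[Fy /cent1P cxy].
apply/set1P; apply: (not_pi1_regular vq pi1'q Gx _ ox) => //.
  exact: subsetP (Fitting_sub _) y Fy.
exact: mem_p_elt piF Fy.
Qed.

Lemma not_pi1_coprime_Fitting q : pg_vert G sigma q -> q \notin pi1 -> coprime #|F| q.
Proof.
move=> /andP[+ _] pi1'q; rewrite mem_primes => /and3P[pr_q _ _].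
rewrite coprime_sym prime_coprime //; apply: contra pi1'q => qF.
exact: (pgroupP piF).
Qed.

Lemma pi2_vert_not_pi1 : exists p2, [/\ pg_vert G sigma p2, p2 \notin pi1
  & forall q, q \in pi2 <-> pg_connected G sigma p2 q].
Proof.
have [p2 [v2 def2]] := comp2; exists p2; split=> //.
by apply/negP=> pi1p2; case: disj; exists p2; split=> //; apply/def2/pg_connected_refl.
Qed.

Lemma quotient_Fitting_neq1 : F != 1 :> {set _}.
Proof.
have [p2 [v2 _ _]] := pi2_vert_not_pi1; have := vert_quotient_dvd v2.
have [+ _] := andP v2; rewrite mem_primes => /and3P[pr_p2 _ _].
apply: contraTneq => F1; have: Gb \subset [1].
  rewrite -F1 (subset_trans _ (solvable_cent_Fitting solGb)) //.
  by rewrite subsetI subxx /= -/F F1 cents1.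
by move/trivgP->; rewrite cards1 Euclid_dvd1.
Qed.

(** Elements of such prime orders act on [F] without fixed points, so [regular_primes_adjacent]
    joins [q] to the base vertex of [pi2]. *)
Lemma not_pi1_pi2 q : pg_vert G sigma q -> q \notin pi1 -> q \in pi2.
Proof.
move=> vq pi1'q; have [p [vp pi1'p def2]] := pi2_vert_not_pi1; apply/def2.
have [-> | neq_qp] := eqVneq q p; first exact: pg_connected_refl.
apply: (pg_connected_adj (pg_connected_refl vp) vq).
have [+ s'p] := andP vp; rewrite mem_primes => /and3P[pr_p _ _].
have [+ s'q] := andP vq; rewrite mem_primes => /and3P[pr_q _ _].
have neq_pq : p != q by rewrite eq_sym.
have [] := @regular_primes_adjacent _ Gb p q; rewrite ?vert_quotient_dvd //.
- exact: quotient_Fitting_neq1.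
- exact: not_pi1_coprime_Fitting.
- exact: not_pi1_coprime_Fitting.
- by move=> x Gx /orP[]/eqP ox; apply: not_pi1_cent1_Fitting ox.
by move=> xb Gxb oxb; apply: (@quotient_pcore_adj _ G sigma p q xb).
Qed.

Variables G1 G2 : {group gT}.
Hypotheses (nsG1 : G1 <| G) (nsG2 : G2 <| G) (sG01 : G0 \subset G1) (sG12 : G1 \subset G2).
Hypotheses (defG1 : 'F(Gb) = G1 / G0) (defG2 : 'O_sigma(G / G1) = G2 / G1).

Let sigmaG2 : sigma.-group (G2 / G1).
Proof. by rewrite -defG2; apply: pcore_pgroup. Qed.

(** A prime in [sigma] is excluded because [G2] absorbs the [sigma]-core of [G / G1], and a prime in
    [pi1] by [pcore_quotient_Fitting_trivial] with [S = G2 / G0]. *)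
Lemma pi2_Fitting_quotient : pi2.-group 'F(G / G2).
Proof.
apply/pgroupP=> q pr_q qF.
have ntO : 'O_q(G / G2) != 1.
  rewrite -p_core_Fitting -cardG_gt1 (card_Hall (nilpotent_pcore_Hall q (Fitting_nil _))).
  by rewrite p_part_gt1 mem_primes pr_q cardG_gt0.
have qG : q \in \pi(G).
  rewrite mem_primes pr_q cardG_gt0 (dvdn_trans qF) //.
  by rewrite (dvdn_trans (cardSg (Fitting_sub _))) ?dvdn_quotient.
have s'q : q \notin sigma.
  apply: contra ntO => sq; rewrite -subG1.
  have /eqP <- : 'O_sigma(G / G2) == 1.
    rewrite -(isog_eq1 (isog_pcore sigma (third_isog sG12 nsG1 nsG2))) -defG2.
    by rewrite /= trivg_pcore_quotient.
  by apply: sub_pcore => r /eqnP->.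
have vq : pg_vert G sigma q by apply/andP.
apply: not_pi1_pi2 => //; apply: contra ntO => pi1q.
have sG02 := subset_trans sG01 sG12.
have nsG1G2 : G1 <| G2 := normalS sG12 (normal_sub nsG2) nsG1.
have nsG0G2 : G0 <| G2 := normalS sG02 (normal_sub nsG2) nsG0.
rewrite -(isog_eq1 (isog_pcore q (third_isog sG02 nsG0 nsG2))).
have [p2 [v2 pi1'p2 _]] := pi2_vert_not_pi1.
have [+ s'p2] := andP v2; rewrite mem_primes => /and3P[pr_p2 _ _].
apply/eqP; apply: (@pcore_quotient_Fitting_trivial _ Gb sigma pi1 q p2) => //.
- exact: pi1_sigma'.
- by move=> b y Gbb Gby ob; apply: not_pi1_regular v2 pi1'p2 Gbb Gby ob.
- exact: quotient_normal.
- by rewrite /= defG1 quotientS.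
- by rewrite /= defG1 (isog_pgroup sigma (third_isog sG01 nsG0G2 nsG1G2)).
exact: vert_quotient_dvd.
Qed.

Lemma pi2'_series : pi2^'.-group G2.
Proof.
have pi2's p : p \in sigma -> p \in pi2^'.
  by move=> sp; apply/negP=> /(component_vert comp2)/andP[_]; rewrite sp.
have pi2'1 p : p \in pi1 -> p \in pi2^'.
  by move=> p1; apply/negP=> p2; case: disj; exists p.
have nsG1G2 : G1 <| G2 := normalS sG12 (normal_sub nsG2) nsG1.
have nsG0G1 : G0 <| G1 := normalS sG01 (normal_sub nsG1) nsG0.
apply: (pgroup_extension nsG1G2); last exact: sub_pgroup sigmaG2.
apply: (pgroup_extension nsG0G1); first exact: sub_pgroup (pcore_pgroup _ _).
by rewrite -defG1; apply: sub_pgroup piF.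
Qed.

(** [G2] is a [q^']-group, so [E] lifts to an isomorphic subgroup of [G], whose image in [Gb] acts
    on [F] with no nontrivial fixed points. *)
Lemma pi2_abelem_cyclic (q : nat) (E : {group coset_of G2}) :
  q \in \pi('F(G / G2)) -> E \subset G / G2 -> q.-abelem E -> cyclic E.
Proof.
move=> qF sEG abE; have pr_q : prime q by move: qF; rewrite mem_primes => /andP[].
have pi2q : q \in pi2.
  by move: qF; rewrite mem_primes => /and3P[_ _]; apply: (pgroupP pi2_Fitting_quotient).
have vq := component_vert comp2 pi2q; have [_ s'q] := andP vq.
have pi1'q : q \notin pi1 by apply/negP=> pi1q; case: disj; exists q.
have q'G2 : q^'.-group G2 by apply: pi'_p'group pi2'_series pi2q.
have q'G0 : q^'.-group G0 by apply: pi_p'group (pcore_pgroup _ _) s'q.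
have [Q [sQG qQ isoQE]] := quotient_pgroup_lift nsG2 q'G2 sEG (abelem_pgroup abE).
have nQG0 := subset_trans sQG (normal_norm nsG0).
have isoQ : Q \isog Q / G0.
  by apply: quotient_isog => //; rewrite coprime_TIg // coprime_sym (pnat_coprime qQ).
have abQ : q.-abelem (Q / G0) by rewrite -(isog_abelem isoQ) (isog_abelem isoQE).
rewrite -(isog_cyclic isoQE) (isog_cyclic isoQ).
have sQGb : Q / G0 \subset Gb := quotientS G0 sQG.
apply: (@regular_abelem_cyclic _ F (Q / G0)%G q) => //.
- exact: Fitting_nil.
- exact: quotient_Fitting_neq1.
- exact: subset_trans sQGb (gFnorm _ _).
- exact: not_pi1_coprime_Fitting.
move=> x Qx ntx; apply: (not_pi1_cent1_Fitting vq pi1'q) (subsetP sQGb x Qx) _.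
exact: abelem_order_p abQ Qx ntx.
Qed.

End TwoComponents.

Theorem theoremA (gT : finGroupType) (G : {group gT}) (sigma pi1 pi2 : nat_pred) :
  solvable G ->
  cut_set G sigma ->
  pg_component G sigma pi1 ->
  pg_component G sigma pi2 ->
  ~ (exists p, p \in pi1 /\ p \in pi2) ->
  {subset \pi('F(G / 'O_sigma(G))) <= pi1} ->
  exists G0 G1 G2 G3 : {group gT},
    [/\ G0 <| G, G1 <| G, G2 <| G & G3 <| G] /\
    [/\ G0 \subset G1, G1 \subset G2 & G2 \subset G3] /\
    (sigma.-group G0 /\ sigma.-group (G2 / G1)) /\
    (nilpotent (G1 / G0) /\ pi1.-group (G1 / G0)) /\
    (nilpotent (G3 / G2) /\ pi2.-group (G3 / G2)) /\
    (~~ nilpotent (G / G3) ->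
       [/\ 2 \in pi2,
            binary_octahedral (G / 'O_(2^')(G))%G &
            fitting_length (G / G3)%G = 2%N]).
Proof.
move=> solG _ comp1 comp2 disj pi1F.
have nsG0 : 'O_sigma(G) <| G := pcore_normal sigma G.
have [G1 defG1 sG01 nsG1] := inv_quotientN nsG0 (Fitting_normal (G / 'O_sigma(G))).
have [G2 defG2 sG12 nsG2] := inv_quotientN nsG1 (pcore_normal sigma (G / G1)).
have [G3 defG3 sG23 nsG3] := inv_quotientN nsG2 (Fitting_normal (G / G2)).
have pi2F : pi2.-group 'F(G / G2).
  exact: (pi2_Fitting_quotient solG comp1 comp2 disj pi1F nsG1 nsG2 sG01 sG12 defG1 defG2).
exists 'O_sigma(G)%G, G1, G2, G3; split=> //; split=> //.
split; first by split; last rewrite -defG2; apply: pcore_pgroup.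
split; first by rewrite -defG1 Fitting_nil pgroup_of_primes.
split; first by rewrite -defG3 Fitting_nil.
move=> nnil; have nnilH : ~~ nilpotent (G / G2 / 'F(G / G2)).
  by rewrite defG3 (isog_nil (third_isog sG23 nsG2 nsG3)).
have rank1 := pi2_abelem_cyclic solG comp1 comp2 disj pi1F nsG1 nsG2 sG01 sG12 defG1 defG2.
have [pi2_2 der2 octH] :=
  rank1_Fitting_exceptional (quotient_sol G2 solG) rank1 nnilH.
have pi2two : 2 \in pi2 by apply: (pgroupP pi2F) => //; move: pi2_2; rewrite mem_primes => /and3P[].
have oddG2 : 2^'.-group G2.
  have pi2'G2 := pi2'_series comp2 disj pi1F nsG1 nsG2 sG01 sG12 defG1 defG2.
  exact: pi'_p'group pi2'G2 pi2two.
split; first exact: pi2two.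
  (* As [G2] has odd order, the odd core of [G / G2] is the image of that of [G]. *)
  apply: binary_octahedral_isog octH; rewrite /= pquotient_pcore //.
  by apply: third_isog => //; [apply: pcore_max | apply: pcore_normal].
apply: fitting_length_metabelian => //.
have nG2G := normal_norm nsG2; have nG3G := normal_norm nsG3.
(* The second derived subgroup of [G / G2] lies in its Fitting subgroup [G3 / G2], so [G / G3] is
   metabelian. *)
apply/derG1P; rewrite -[_^`(1)^`(1)]/((G / G3)^`(2)) -quotient_der //.
apply/trivgP; rewrite quotient_sub1; last exact: subset_trans (der_sub 2 G) nG3G.
rewrite -(quotientSGK (subset_trans (der_sub 2 G) nG2G) sG23) -defG3 quotient_der //.
Qed.
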